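(* Let $\Omega=\{(a_1,a_2,a_3)\in\mathbb{R}^3 \mid Q(a_1,a_2,a_3)=0\}$, where $Q$ is the symmetric polynomial of degree $12$ given in the context. With respect to the standard topology of $\mathbb{R}^3$: (1) the set $(0,1/2)^3\cap\Omega$ is connected; (2) the set $(0,1/2)^3\setminus\Omega$ consists of three connected components (i.e. it has exactly three connected components).
   Context: For $(a_1,a_2,a_3)\in\mathbb{R}^3$ put $s_1=a_1+a_2+a_3$, $s_2=a_1a_2+a_1a_3+a_2a_3$, $s_3=a_1a_2a_3$, and define $$\begin{aligned}Q(a_1,a_2,a_3)={}&(2s_1+4s_3-1)\bigl(64s_1^5-64s_1^4+8s_1^3+12s_1^2-6s_1+1\\&\quad+240s_3s_1^2-240s_3s_1-1536s_3^2s_1-4096s_3^3+60s_3+768s_3^2\bigr)\\&-8s_1(2s_1+4s_3-1)(2s_1-32s_3-1)(10s_1+32s_3-5)s_2\\&-16s_1^2(13-52s_1+640s_3s_1+1024s_3^2-320s_3+52s_1^2)s_2^2\\&+64(2s_1-1)(2s_1-32s_3-1)s_2^3+2048s_1(2s_1-1)s_2^4.\end{aligned}$$ Here $(0,1/2)^3$ denotes the open cube $\{(a_1,a_2,a_3) : 0<a_i<1/2,\ i=1,2,3\}$. *)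

(* Defs.v *)
From mathcomp Require Import all_boot all_order all_algebra.
From mathcomp Require Import all_classical all_reals all_analysis.

Set Implicit Arguments.
Unset Strict Implicit.
Unset Printing Implicit Defensive.

Import Order.TTheory GRing.Theory Num.Theory.
Import numFieldNormedType.Exports.

Local Open Scope classical_set_scope.
Local Open Scope ring_scope.

Definition Q (R : realType) (a1 a2 a3 : R) : R :=
  let s1 := a1 + a2 + a3 in
  let s2 := a1 * a2 + a1 * a3 + a2 * a3 in
  let s3 := a1 * a2 * a3 in
  (2 * s1 + 4 * s3 - 1)
    * (64 * s1 ^+ 5 - 64 * s1 ^+ 4 + 8 * s1 ^+ 3 + 12 * s1 ^+ 2 - 6 * s1 + 1
       + 240 * s3 * s1 ^+ 2 - 240 * s3 * s1 - 1536 * s3 ^+ 2 * s1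
       - 4096 * s3 ^+ 3 + 60 * s3 + 768 * s3 ^+ 2)
  - 8 * s1 * (2 * s1 + 4 * s3 - 1) * (2 * s1 - 32 * s3 - 1)
      * (10 * s1 + 32 * s3 - 5) * s2
  - 16 * s1 ^+ 2
      * (13 - 52 * s1 + 640 * s3 * s1 + 1024 * s3 ^+ 2 - 320 * s3
         + 52 * s1 ^+ 2) * s2 ^+ 2
  + 64 * (2 * s1 - 1) * (2 * s1 - 32 * s3 - 1) * s2 ^+ 3
  + 2048 * s1 * (2 * s1 - 1) * s2 ^+ 4.

(* The entries of a row vector are indexed from 0, so a1, a2, a3 are
   a 0 0, a 0 1, a 0 2, where 0, 1, 2 are read in the ring 'I_3. *)
Definition Omega (R : realType) : set 'rV[R]_3 :=
  [set a | Q (a 0 0) (a 0 1) (a 0 2) = 0].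

Definition open_cube (R : realType) : set 'rV[R]_3 :=
  [set a | forall i : 'I_3, 0 < a 0 i < 1 / 2].

Arguments Omega : clear implicits.
Arguments open_cube : clear implicits.

Definition components (T : topologicalType) (A : set T) : set (set T) :=
  connected_component A @` A.

(* Main.v *)
(* For t1 + t2 + t3 = 0 put d_i = a_j t_j + a_k t_k - a_i t_i and kappa = 2 s1 - 1. Then -Q is
   the discriminant of the binary cubic 4 d1 d2 d3 + kappa t1 t2 t3. If a1 <= a2 <= a3, the signs
   of the cubic at the zeros of t1 t2 t3, together with a monotonicity argument, show that it has
   exactly one root with t1, t3 < 0 < t2 and that further real roots satisfy t1 < 0 < t2, t3.
   Hence Q <= 0 iff 4 w >= kappa for some value w = d1 d2 d3 / (- t1 t2 t3) taken there.

   Such a w is homogeneous of degree 3 in a, and AM-GM gives w <= (2 s1 / 3)^3. So along a ray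
   from the origin Q goes from negative to positive below the plane s1 = 3/4 and never returns to
   negative before that plane, which meets {Q <= 0} only at the centre c = (1/4, 1/4, 1/4); beyond
   it the roles are reversed. The three components are {Q < 0, s1 < 3/4}, which contracts to the
   origin, {Q < 0, s1 > 3/4}, which contracts to the diagonal, and {Q > 0}, which is pushed along
   rays to the plane s1 = 3/4, where the cube cuts out a hexagon, punctured at c. In the chamber
   a1 <= a2 <= a3 each of the two sheets of Q = 0 is a graph over such rays (or over segments
   towards the diagonal), so that moving the ray gives a path from any point of the sheet to c. *)
Require Import Defs.
From mathcomp Require Import all_boot all_order all_algebra.
From mathcomp Require Import all_classical all_reals all_analysis.
From mathcomp Require Import ring lra.
Import Order.TTheory GRing.Theory Num.Theory.
Import numFieldNormedType.Exports.
Local Open Scope classical_set_scope.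
Local Open Scope card_scope.
Local Open Scope ring_scope.

Set Implicit Arguments.
Unset Strict Implicit.
Unset Printing Implicit Defensive.

(** * Linear interpolation *)

Definition lerp (R : realType) (t p q : R) : R := p + t * (q - p).

Section Lerp.
Variable R : realType.

Lemma lerp0 (p q : R) : lerp 0 p q = p. Proof. by rewrite /lerp mul0r addr0. Qed.

Lemma lerp1 (p q : R) : lerp 1 p q = q. Proof. by rewrite /lerp mul1r addrC subrK. Qed.

Lemma lerpp (t p : R) : lerp t p p = p. Proof. by rewrite /lerp subrr mulr0 addr0. Qed.

Lemma lerpD (t p q p' q' : R) : lerp t p q + lerp t p' q' = lerp t (p + p') (q + q').
Proof. rewrite /lerp; ring. Qed.

Lemma lerp_scale (t l p : R) : lerp t p (l * p) = lerp t 1 l * p.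
Proof. rewrite /lerp; ring. Qed.

Lemma ler_lerp (t p q p' q' : R) : 0 <= t <= 1 -> p <= q -> p' <= q' ->
  lerp t p p' <= lerp t q q'.
Proof.
move=> /andP[t0 t1] pq pq'; rewrite -subr_ge0.
have -> : lerp t q q' - lerp t p p' = (1 - t) * (q - p) + t * (q' - p').
  by rewrite /lerp; ring.
by rewrite addr_ge0 // mulr_ge0 // subr_ge0.
Qed.

Lemma ltr_lerp (t p q p' q' : R) : 0 <= t <= 1 -> p < q -> p' < q' ->
  lerp t p p' < lerp t q q'.
Proof.
move=> /andP[t0 t1] pq pq'; rewrite -subr_gt0.
have -> : lerp t q q' - lerp t p p' = (1 - t) * (q - p) + t * (q' - p').
  by rewrite /lerp; ring.
move: t0; rewrite le_eqVlt => /orP[/eqP <-|t0].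
  by rewrite mul0r addr0 subr0 mul1r subr_gt0.
by rewrite ltr_wpDl ?mulr_ge0 ?mulr_gt0 ?subr_ge0 ?subr_gt0 // ltW.
Qed.

Lemma lerp_le (t p q u : R) : 0 <= t <= 1 -> p <= u -> q <= u -> lerp t p q <= u.
Proof. by move=> ht pu qu; rewrite -[leRHS](lerpp t) ler_lerp. Qed.

Lemma le_lerp (t p q l : R) : 0 <= t <= 1 -> l <= p -> l <= q -> l <= lerp t p q.
Proof. by move=> ht lp lq; rewrite -[leLHS](lerpp t) ler_lerp. Qed.

Lemma lerp_lt (t p q u : R) : 0 <= t <= 1 -> p < u -> q < u -> lerp t p q < u.
Proof. by move=> ht pu qu; rewrite -[ltRHS](lerpp t) ltr_lerp. Qed.

Lemma lt_lerp (t p q l : R) : 0 <= t <= 1 -> l < p -> l < q -> l < lerp t p q.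
Proof. by move=> ht lp lq; rewrite -[ltLHS](lerpp t) ltr_lerp. Qed.
End Lerp.

(** * The discriminant *)

Definition disc3 (R : realType) (a b c d : R) : R :=
  b ^+ 2 * c ^+ 2 - 4 * a * c ^+ 3 - 4 * b ^+ 3 * d - 27 * a ^+ 2 * d ^+ 2
  + 18 * a * b * c * d.

(* The cubic 4 d1 d2 d3 + kappa t1 t2 t3 at t = (w, - w - 1, 1). *)
Definition pencil (R : realType) (a1 a2 a3 w : R) : R :=
  4 * ((a1 + a2) * w - (a3 - a2)) * ((a2 - a1) * w + (a2 + a3))
    * ((a1 + a2) * w + (a2 + a3))
  - (2 * (a1 + a2 + a3) - 1) * (w * (w + 1)).

Definition pcoef3 (R : realType) (a1 a2 a3 : R) : R :=
  4 * ((a1 + a2) ^+ 2 * (a2 - a1)).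
Definition pcoef2 (R : realType) (a1 a2 a3 : R) : R :=
  4 * ((a1 + a2) * (a2 - a1) * (a2 + a3) + (a1 + a2) ^+ 2 * (a2 + a3)
       - (a3 - a2) * (a1 + a2) * (a2 - a1)) - (2 * (a1 + a2 + a3) - 1).
Definition pcoef1 (R : realType) (a1 a2 a3 : R) : R :=
  4 * ((a1 + a2) * (a2 + a3) ^+ 2
       - (a3 - a2) * ((a2 - a1) * (a2 + a3) + (a1 + a2) * (a2 + a3)))
  - (2 * (a1 + a2 + a3) - 1).
Definition pcoef0 (R : realType) (a1 a2 a3 : R) : R :=
  - 4 * ((a3 - a2) * (a2 + a3) ^+ 2).

Section Algebra.
Variable R : realType.

Lemma pencilE (a1 a2 a3 w : R) : pencil a1 a2 a3 w =
  pcoef3 a1 a2 a3 * w ^+ 3 + pcoef2 a1 a2 a3 * w ^+ 2 + pcoef1 a1 a2 a3 * w + pcoef0 a1 a2 a3.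
Proof. rewrite /pencil /pcoef3 /pcoef2 /pcoef1 /pcoef0; ring. Qed.

Lemma Q_disc (a1 a2 a3 : R) : Q a1 a2 a3 =
  - disc3 (pcoef3 a1 a2 a3) (pcoef2 a1 a2 a3) (pcoef1 a1 a2 a3) (pcoef0 a1 a2 a3).
Proof. rewrite /Q /disc3 /pcoef3 /pcoef2 /pcoef1 /pcoef0 /=. ring. Qed.

(** With the first two arguments equal, [pcoef3] vanishes and [pcoef2] and [pcoef1] coincide, so the
    discriminant collapses to b^3 (b - 4 d) with b = [pcoef2] and d = [pcoef0]. *)
Lemma Q_pair (p o : R) : Q p p o =
  - ((16 * (p + o) * p ^+ 2 - (2 * (p + p + o) - 1)) ^+ 3
     * (16 * (p + o) * o ^+ 2 - (2 * (p + p + o) - 1))).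
Proof. rewrite /Q /=; ring. Qed.

Lemma Q_swap12 (a1 a2 a3 : R) : Q a2 a1 a3 = Q a1 a2 a3.
Proof. by rewrite /Q (addrC a2 a1) (mulrC a2 a1) (addrAC _ (a2 * a3)). Qed.

Lemma Q_swap23 (a1 a2 a3 : R) : Q a1 a3 a2 = Q a1 a2 a3.
Proof.
by rewrite /Q (addrAC a1 a3 a2) (mulrAC a1 a3 a2) (mulrC a3 a2) (addrC (a1 * a3)).
Qed.

(** Dividing out the root x leaves a quadratic cofactor; the discriminant of the cubic is that of
    the cofactor times the squared value of the cofactor at x. *)
Lemma disc3_root (a b c d x : R) : a * x ^+ 3 + b * x ^+ 2 + c * x + d = 0 ->
  disc3 a b c d =
  ((b + a * x) ^+ 2 - 4 * a * (c + b * x + a * x ^+ 2)) * (a * x ^+ 2 + (b + a * x) * x + (c +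
    b * x + a * x ^+ 2)) ^+ 2.
Proof.
move=> h; have -> : d = - (a * x ^+ 3 + b * x ^+ 2 + c * x) by lra.
rewrite /disc3; ring.
Qed.

(** The estimate behind [pencil_mid] and [wall_bound_outer]. In terms of A <= B the left side is at
    most 2 A + B - 1, because 2 a3 >= B. *)
Lemma wall_bound (a1 a2 a3 : R) : 0 <= a1 -> 0 < a2 -> a1 <= a2 <= a3 -> a1 < a3 -> a2 + a3 <=
  1 ->
  2 * (a1 + a2 + a3) - 1 < 4 * (a1 + a3) * (a2 + a3) ^+ 2.
Proof.
move=> h1 h2 /andP[h12 h23] h13 hB.
set A := a1 + a3; set B := a2 + a3.
have e : 2 * (a1 + a2 + a3) - 1 = 2 * A + 2 * B - 2 * a3 - 1 by rewrite /A /B; ring.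
have [hh|hh] := leP 1 (2 * B ^+ 2).
  have : 0 <= A * (2 * B ^+ 2 - 1) by apply: mulr_ge0; rewrite /A; lra.
  have : A * (2 * B ^+ 2 - 1) + (1 - B) > 0.
    have [hB1|hB1] := ltP B 1.
      by apply: ltr_wpDl; [apply: mulr_ge0; rewrite /A; lra|lra].
    have -> : B = 1 by apply/eqP; rewrite eq_le hB hB1.
    rewrite /A; lra.
  rewrite e /A /B in hh *; nra.
(* Now A may be replaced by B, and the claim becomes 4 B^3 - 3 B + 1 >= 0, which is this product.
   Strictness comes from A < B if a1 < a2, and from 2 a3 > B otherwise. *)
have : 0 <= (2 * B - 1) ^+ 2 * (B + 1).
  by apply: mulr_ge0; [exact: sqr_ge0|rewrite /B; lra].
have : 0 <= (B - A) * (1 - 2 * B ^+ 2) by apply: mulr_ge0; rewrite /A /B in hh *; lra.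
have [h12'|h12'] := ltP a1 a2.
  have : 0 < (B - A) * (1 - 2 * B ^+ 2) by apply: mulr_gt0; rewrite /A /B in hh *; lra.
  rewrite e; move=> ? _ ?.
  have ? : 2 * a3 >= B by rewrite /B; lra.
  nra.
have ? : 2 * a3 > B by rewrite /B; lra.
rewrite e; nra.
Qed.

(** Excludes roots with t1, t2 <= 0 < t3. Up to sign, one factor is at least u (a1 + a3) and the
    product of the other two at least (1 - u) (a2 + a3)^2, so [wall_bound] outweighs the term with
    kappa. *)
Lemma pencil_mid (a1 a2 a3 u : R) : 0 <= a1 -> 0 < a2 -> a1 < a2 -> a2 < a3 -> a2 + a3 <= 1 ->
  0 <= u <= 1 -> pencil a1 a2 a3 (- u) < 0.
Proof.
move=> h1 h2 h12 h23 hB /andP[u0 u1].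
have hE : 2 * (a1 + a2 + a3) - 1 < 4 * (a1 + a3) * (a2 + a3) ^+ 2.
  by apply: wall_bound => //; lra.
set k := 2 * _ - 1 in hE.
have -> : pencil a1 a2 a3 (- u) = - (4 * ((a1 + a2) * u + (a3 - a2))
   * (((a2 + a3) - (a2 - a1) * u) * ((a2 + a3) - (a1 + a2) * u)) - k * (u * (1 - u))).
  by rewrite /pencil -/k; ring.
rewrite oppr_lt0 subr_gt0.
have e : ((a2 + a3) - (a2 - a1) * u) * ((a2 + a3) - (a1 + a2) * u)
  = (1 - u) * (a2 + a3) ^+ 2 + (u * ((a2 + a3) * (a3 - a2)) + u ^+ 2 * ((a2 - a1) * (a2 + a1))).
  by ring.
have h5 : 0 < (a2 + a3) * (a3 - a2) by apply: mulr_gt0; lra.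
have h6 : 0 <= u ^+ 2 * ((a2 - a1) * (a2 + a1)).
  by apply: mulr_ge0; [exact: sqr_ge0|apply: mulr_ge0; lra].
have h7 : 0 <= u * (1 - u) by apply: mulr_ge0; lra.
have h8 : 0 <= u * ((a2 + a3) * (a3 - a2)) by apply: mulr_ge0; lra.
have hX : u * (a1 + a3) <= (a1 + a2) * u + (a3 - a2) by nra.
have hX0 : 0 < (a1 + a2) * u + (a3 - a2).
  by apply: ltr_wpDl; [apply: mulr_ge0; lra|lra].
have hC : 0 < (a2 + a3) ^+ 2 by apply: exprn_gt0; lra.
rewrite e.
have [->|un0] := eqVneq u 0.
  rewrite !(mul0r, mulr0, subr0, mul1r, add0r, addr0, expr0n) /=.
  by rewrite !mulr_gt0 //; lra.
have up : 0 < u by rewrite lt_neqAle eq_sym un0.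
set X := (a1 + a2) * u + (a3 - a2) in hX hX0 *.
set H := (a2 + a3) * (a3 - a2) in h5 h8 *.
set T := u ^+ 2 * _ in h6 *.
set C := (a2 + a3) ^+ 2 in hE hC *.
have q1 : 0 < X * (u * H) := mulr_gt0 hX0 (mulr_gt0 up h5).
have q2 : 0 <= X * T := mulr_ge0 (ltW hX0) h6.
have q3 : 0 <= (X - u * (a1 + a3)) * ((1 - u) * C).
  apply: mulr_ge0; [lra|apply: mulr_ge0; [lra|exact: ltW]].
have q4 : 0 <= (u * (1 - u)) * (4 * (a1 + a3) * C - k).
  by apply: mulr_ge0 => //; lra.
lra.
Qed.

(** The polynomial is the cofactor of the root x. The identity [e] amounts to the divided difference
    of the cubic over w (w + 1): kappa drops out and all remaining terms are positive. Hence x is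
    simple and the only positive root. *)
Lemma pencil_pos (a1 a2 a3 w x : R) : 0 <= a1 -> 0 < a2 -> a1 < a2 -> a2 < a3 ->
  0 < x -> 0 < w -> pencil a1 a2 a3 x = 0 ->
  0 < pcoef3 a1 a2 a3 * w ^+ 2 + (pcoef2 a1 a2 a3 + pcoef3 a1 a2 a3 * x) * w
      + (pcoef1 a1 a2 a3 + pcoef2 a1 a2 a3 * x + pcoef3 a1 a2 a3 * x ^+ 2).
Proof.
move=> h1 h2 h12 h23 x0 w0 hx.
set q := _ + _ + _.
have e : q * (x ^+ 2 + x) = 4 * ((a1 + a2) ^+ 2 * (a2 - a1) * (w ^+ 2 * x ^+ 2 + w * x * (w + x))
   + (a3 - a2) * (a2 - a1) * (a3 - a1) * (w * x)
   + (a3 - a2) * (a2 + a3) ^+ 2 * (w + x + 1)) + (w + x + 1) * pencil a1 a2 a3 x.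
  by rewrite /q /pencil /pcoef3 /pcoef2 /pcoef1; ring.
have hxx : 0 < x ^+ 2 + x by rewrite addr_gt0 // exprn_gt0.
rewrite -(pmulr_lgt0 _ hxx) e hx mulr0 addr0 pmulr_rgt0 //.
have d1 : 0 < a2 - a1 by lra.
have d2 : 0 < a3 - a2 by lra.
have d3 : 0 < a3 - a1 by lra.
have d4 : 0 < a2 + a3 by lra.
have d5 : 0 < a1 + a2 by lra.
by repeat first [assumption | exact: ltr01 | apply: addr_gt0 | apply: mulr_gt0 | apply:
  exprn_gt0].
Qed.

Lemma pencil_root (a1 a2 a3 : R) : 0 <= a1 -> 0 < a2 -> a1 < a2 -> a2 < a3 ->
  exists2 x, 0 < x & pencil a1 a2 a3 x = 0.
Proof.
move=> h1 h2 h12 h23.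
pose p := (((pcoef3 a1 a2 a3)%:P * 'X + (pcoef2 a1 a2 a3)%:P) * 'X + (pcoef1 a1 a2 a3)%:P) * 'X
  + (pcoef0 a1 a2 a3)%:P.
have pE x : p.[x] = pencil a1 a2 a3 x.
  rewrite pencilE /p !(hornerD, hornerMX, hornerC); ring.
(* A Cauchy bound: M >= 1, and [pcoef3] times M exceeds the sum of the absolute values of the other
   coefficients, so the cubic is nonnegative at M. *)
pose M := 1 + (`|pcoef2 a1 a2 a3| + `|pcoef1 a1 a2 a3| + `|pcoef0 a1 a2 a3|) / pcoef3 a1 a2 a3.
have c3 : 0 < pcoef3 a1 a2 a3.
  by rewrite /pcoef3 mulr_gt0 // mulr_gt0 ?exprn_gt0 //; lra.
have M1 : 1 <= M by rewrite lerDl divr_ge0 ?addr_ge0 // ltW.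
have hM : pcoef3 a1 a2 a3 * M = pcoef3 a1 a2 a3 + (`|pcoef2 a1 a2 a3| + `|pcoef1 a1 a2 a3| +
  `|pcoef0 a1 a2 a3|).
  by rewrite /M mulrDr mulr1 mulrC divfK // gt_eqF.
have p00 : pencil a1 a2 a3 0 = - (4 * ((a3 - a2) * ((a2 + a3) * (a2 + a3)))).
  by rewrite /pencil; ring.
have p0 : p.[0] <= 0.
  rewrite pE p00.
  have : 0 <= (a3 - a2) * ((a2 + a3) * (a2 + a3)) by rewrite !mulr_ge0 //; lra.
  lra.
have pM : 0 <= p.[M].
  rewrite pE pencilE.
  have -> : pcoef3 a1 a2 a3 * M ^+ 3 = (pcoef3 a1 a2 a3 * M) * M ^+ 2 by ring.
  rewrite hM.
  have b2 := ler_norm (- pcoef2 a1 a2 a3); have b1 := ler_norm (- pcoef1 a1 a2 a3).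
  have b0 := ler_norm (- pcoef0 a1 a2 a3); rewrite !normrN in b2 b1 b0.
  have M2 : M <= M ^+ 2 by rewrite expr2 ler_peMl //; lra.
  have t2 : 0 <= (pcoef2 a1 a2 a3 + `|pcoef2 a1 a2 a3|) * M ^+ 2.
    by rewrite mulr_ge0 ?sqr_ge0 //; lra.
  have t1 : 0 <= (pcoef1 a1 a2 a3 + `|pcoef1 a1 a2 a3|) * M by rewrite mulr_ge0 //; lra.
  have t3 : 0 <= `|pcoef1 a1 a2 a3| * (M ^+ 2 - M) by rewrite mulr_ge0 //; lra.
  have t4 : 0 <= `|pcoef0 a1 a2 a3| * (M ^+ 2 - 1) by rewrite mulr_ge0 //; lra.
  have t5 : 0 <= pcoef3 a1 a2 a3 * M ^+ 2 by rewrite mulr_ge0 ?sqr_ge0 // ltW.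
  lra.
have M0 : 0 <= M by lra.
have [x /andP[hx _] /rootP px] := @poly_ivt _ p 0 M M0 (introT andP (conj p0 pM)).
exists x; last by rewrite -pE.
rewrite lt_neqAle hx andbT; apply: contra_eq_neq px => <-; rewrite pE.
rewrite p00.
have : 0 < (a3 - a2) * ((a2 + a3) * (a2 + a3)) by rewrite !mulr_gt0 //; lra.
move=> h; apply/eqP => h'; lra.
Qed.
End Algebra.

(** * Real roots of the cubic *)

(* w is the value of d1 d2 d3 / (- t1 t2 t3) at (-1, t, 1 - t); for a1 = a2 this is 0 / 0 at
   t = 1, and the second alternative is the limit there. *)
Definition wit (R : realType) (a1 a2 a3 w : R) : Prop :=
  (exists2 t, 0 < t < 1 & w * (t * (1 - t)) =
     (a1 + t * a2 + (1 - t) * a3) * (a1 - t * a2 + (1 - t) * a3)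
     * (a1 + t * a2 - (1 - t) * a3))
  \/ (a1 = a2 /\ w = 4 * a1 ^+ 2 * (a1 + a3)).

Section Witness.
Variable R : realType.

(** The parameter w = -1 / (1 - t) of [pencil] is the point (-1, t, 1 - t) up to scaling; 0 < t < 1
    sweeps out w < -1, the region t1 < 0 < t2, t3. *)
Lemma pencil_wit (a1 a2 a3 t : R) : t < 1 ->
  pencil a1 a2 a3 (- (1 - t)^-1) * (1 - t) ^+ 3 =
  4 * ((a1 + t * a2 + (1 - t) * a3) * (a1 - t * a2 + (1 - t) * a3)
     * (a1 + t * a2 - (1 - t) * a3)) - (2 * (a1 + a2 + a3) - 1) * (t * (1 - t)).
Proof.
move=> t1; rewrite /pencil; field; apply/eqP; lra.
Qed.

Lemma pencil_root_factor (a1 a2 a3 x w : R) : pencil a1 a2 a3 x = 0 ->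
  pencil a1 a2 a3 w = (w - x) * (pcoef3 a1 a2 a3 * w ^+ 2 + (pcoef2 a1 a2 a3 + pcoef3 a1 a2 a3
    * x) * w
      + (pcoef1 a1 a2 a3 + pcoef2 a1 a2 a3 * x + pcoef3 a1 a2 a3 * x ^+ 2)).
Proof.
by move=> hx; rewrite -[LHS]subr0 -hx !pencilE; ring.
Qed.

Lemma pcoef3_gt0 (a1 a2 a3 : R) : 0 <= a1 -> a1 < a2 -> 0 < pcoef3 a1 a2 a3.
Proof. by move=> h h12; rewrite /pcoef3 mulr_gt0 // mulr_gt0 ?exprn_gt0 //; lra. Qed.

Lemma Q_root (a1 a2 a3 x : R) : pencil a1 a2 a3 x = 0 ->
  Q a1 a2 a3 = - (((pcoef2 a1 a2 a3 + pcoef3 a1 a2 a3 * x) ^+ 2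
     - 4 * pcoef3 a1 a2 a3 * (pcoef1 a1 a2 a3 + pcoef2 a1 a2 a3 * x + pcoef3 a1 a2 a3 * x ^+ 2))
  * (pcoef3 a1 a2 a3 * x ^+ 2 + (pcoef2 a1 a2 a3 + pcoef3 a1 a2 a3 * x) * x
      + (pcoef1 a1 a2 a3 + pcoef2 a1 a2 a3 * x + pcoef3 a1 a2 a3 * x ^+ 2)) ^+ 2).
Proof. by move=> hx; rewrite Q_disc (disc3_root (x := x)) // -pencilE. Qed.

(** Such a witness makes the cubic positive at a negative parameter, to the left of its positive
    root. There the cofactor is negative although its leading coefficient is positive, so its
    discriminant is positive; its value at the root is nonzero by [pencil_pos]. *)
Lemma Q_neg_inside (a1 a2 a3 w : R) : 0 <= a1 -> 0 < a2 -> a1 < a2 -> a2 < a3 ->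
  wit a1 a2 a3 w -> 2 * (a1 + a2 + a3) - 1 < 4 * w -> Q a1 a2 a3 < 0.
Proof.
move=> h1 h2 h12 h23 [[t /andP[t0 t1] hw]|[e]] hk; last by rewrite e ltxx in h12.
have hJ := pencil_wit a1 a2 a3 t1; rewrite -hw in hJ.
have [x x0 hx] := pencil_root h1 h2 h12 h23.
have st : 0 < 1 - t by rewrite subr_gt0.
have J0 : 0 < pencil a1 a2 a3 (- (1 - t)^-1).
  rewrite -(pmulr_lgt0 _ (exprn_gt0 3 st)) hJ.
  have -> : 4 * (w * (t * (1 - t))) - (2 * (a1 + a2 + a3) - 1) * (t * (1 - t))
     = (4 * w - (2 * (a1 + a2 + a3) - 1)) * (t * (1 - t)) by ring.
  by rewrite mulr_gt0 ?mulr_gt0 ?subr_gt0.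
have u0 : 0 < (1 - t)^-1 by rewrite invr_gt0.
set u := (1 - t)^-1 in J0 u0.
have hqx := pencil_pos h1 h2 h12 h23 x0 x0 hx.
have c0 := pcoef3_gt0 a3 h1 h12.
rewrite (pencil_root_factor (- u) hx) in J0.
rewrite (Q_root hx) oppr_lt0.
move: (pcoef1 a1 a2 a3 + _ + _) (pcoef2 a1 a2 a3 + _) hqx J0 => c b hqx J0.
rewrite mulr_gt0 ?exprn_gt0 //.
move: (pcoef3 a1 a2 a3) c0 hqx J0 => a c0 _ J0.
have q0 : a * (- u) ^+ 2 + b * (- u) + c < 0.
  by move: J0; rewrite nmulr_rgt0 //; lra.
have : 0 <= (2 * a * (- u) + b) ^+ 2 by exact: sqr_ge0.
have : 0 < a * - (a * (- u) ^+ 2 + b * (- u) + c) by rewrite mulr_gt0 // oppr_gt0.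
lra.
Qed.

(** Without such a witness the cubic is negative at every w <= 0: on [-1, 0] by [pencil_mid], below
    -1 through [pencil_wit]. With [pencil_pos] the cofactor is then positive everywhere, which
    forces Q > 0. *)
Lemma Q_le0_inside (a1 a2 a3 : R) : 0 <= a1 -> 0 < a2 -> a1 < a2 -> a2 < a3 ->
  a2 + a3 <= 1 -> Q a1 a2 a3 <= 0 ->
  exists2 w, wit a1 a2 a3 w & 2 * (a1 + a2 + a3) - 1 <= 4 * w.
Proof.
move=> h1 h2 h12 h23 hB hQ; apply: contrapT => hN.
have [x x0 hx] := pencil_root h1 h2 h12 h23.
have c0 := pcoef3_gt0 a3 h1 h12.
have Jneg (y : R) : y <= 0 -> pencil a1 a2 a3 y < 0.
  move=> y0; have [y1|y1] := leP (-1) y.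
    by rewrite -[y]opprK; apply: pencil_mid => //; apply/andP; split; lra.
  have u1 : 1 < - y by lra.
  have u0 : 0 < (- y)^-1 by rewrite invr_gt0; lra.
  have u2 : (- y)^-1 < 1 by rewrite invf_lt1 //; lra.
  pose t := 1 - (- y)^-1.
  have t0 : 0 < t by rewrite /t; lra.
  have t1 : t < 1 by rewrite /t; lra.
  have st : 0 < 1 - t by lra.
  have hJ := pencil_wit a1 a2 a3 t1.
  have ey : - (1 - t)^-1 = y by rewrite /t opprB addrC subrK invrK opprK.
  rewrite ey in hJ.
  set D := _ * _ * _ in hJ.
  rewrite -(pmulr_llt0 _ (exprn_gt0 3 st)) hJ.
  have tt : 0 < t * (1 - t) by rewrite mulr_gt0.
  have hw : D / (t * (1 - t)) * (t * (1 - t)) = D by rewrite divfK // gt_eqF.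
  rewrite ltNge; apply/negP => h; apply: hN; exists (D / (t * (1 - t))).
    by left; exists t; rewrite ?t0.
  rewrite -subr_ge0 -(pmulr_lge0 _ tt) mulrBl -mulrA hw; lra.
have qpos (y : R) : 0 < pcoef3 a1 a2 a3 * y ^+ 2 + (pcoef2 a1 a2 a3 + pcoef3 a1 a2 a3 * x) * y
      + (pcoef1 a1 a2 a3 + pcoef2 a1 a2 a3 * x + pcoef3 a1 a2 a3 * x ^+ 2).
  have [y0|y0] := ltP 0 y; first exact: pencil_pos.
  have := Jneg _ y0; rewrite (pencil_root_factor y hx) nmulr_rlt0 //; lra.
move: hQ; rewrite (Q_root hx) oppr_le0.
move: (qpos x).
move: (pcoef1 a1 a2 a3 + _ + _) (pcoef2 a1 a2 a3 + _) qpos => c b qpos qx.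
rewrite pmulr_lge0 ?exprn_gt0 //.
move: (pcoef3 a1 a2 a3) c0 qpos {qx} => a c0 qpos.
(* The vertex of the cofactor, where positivity means a negative discriminant. *)
have := qpos (- b / (2 * a)).
have -> : a * (- b / (2 * a)) ^+ 2 + b * (- b / (2 * a)) + c = (4 * a * c - b ^+ 2) / (4 * a).
  by field; apply/eqP; lra.
rewrite pmulr_lgt0 ?invr_gt0; last by lra.
lra.
Qed.

(** Makes the factor of [Q_pair] with a3^2 positive, so that on both walls a1 = a2 and a2 = a3 the
    factor with a1^2 alone decides the sign of Q. *)
Lemma wall_bound_outer (a1 a2 a3 : R) : 0 <= a1 -> 0 < a2 -> a1 <= a2 <= a3 -> a1 < a3 ->
  a1 = a2 \/ a2 = a3 -> a2 + a3 <= 1 ->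
  2 * (a1 + a2 + a3) - 1 < 16 * (a1 + a3) * a3 ^+ 2.
Proof.
move=> h1 h2 h12 h13 hw hB; apply: lt_le_trans (wall_bound h1 h2 h12 h13 hB) _.
have : 0 <= (a1 + a3) * ((a3 - a2) * (3 * a3 + a2)).
  by move/andP: h12 => [? ?]; rewrite !mulr_ge0 //; lra.
lra.
Qed.

Lemma Q_wall_neg (a1 a2 a3 : R) : 0 <= a1 -> a1 <= a3 -> a1 = a2 \/ a2 = a3 ->
  2 * (a1 + a2 + a3) - 1 < 16 * (a1 + a3) * a1 ^+ 2 -> Q a1 a2 a3 < 0.
Proof.
move=> h1 h13 hw hk.
have hk' : 2 * (a1 + a2 + a3) - 1 < 16 * (a1 + a3) * a3 ^+ 2.
  apply: lt_le_trans hk _; apply: ler_wpM2l; first lra.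
  by rewrite lerXn2r ?nnegrE //; lra.
case: hw => e; subst a2.
  by rewrite Q_pair oppr_lt0 mulr_gt0 ?exprn_gt0 ?subr_gt0.
rewrite -Q_swap12 -Q_swap23 Q_pair oppr_lt0 (addrC a3 a1) (addrC _ a1) addrA.
by rewrite mulr_gt0 ?exprn_gt0 ?subr_gt0.
Qed.

Lemma Q_wall_pos (a1 a2 a3 : R) : 0 <= a1 -> 0 < a2 -> a1 <= a2 <= a3 -> a1 < a3 ->
  a1 = a2 \/ a2 = a3 -> a2 + a3 <= 1 ->
  16 * (a1 + a3) * a1 ^+ 2 < 2 * (a1 + a2 + a3) - 1 -> 0 < Q a1 a2 a3.
Proof.
move=> h1 h2 h12 h13 hw hB hk.
have hk' := wall_bound_outer h1 h2 h12 h13 hw hB.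
move: hk hk'; case: hw => <- hk hk'.
  by rewrite Q_pair oppr_gt0 nmulr_rlt0 ?subr_gt0 // exprS pmulr_llt0 ?subr_lt0 //
    exprn_even_gt0 //= lt_eqF // subr_lt0.
rewrite -Q_swap12 -Q_swap23 Q_pair oppr_gt0 (addrC a2 a1) (addrC _ a1) addrA.
by rewrite pmulr_rlt0 ?subr_lt0 // exprn_gt0 // subr_gt0.
Qed.

(** After multiplication by t (1 - t) the defect is (a1 + a3)^2 (a3 - a1) times (1 - t)^3 or (1 - 2
    t)^2. The bound is thus the limit t -> 1 if a1 = a2, and is attained at t = 1/2 if a2 = a3. *)
Lemma wit_wall (a1 a2 a3 w : R) : 0 <= a1 -> 0 < a2 -> a1 <= a2 <= a3 ->
  a1 = a2 \/ a2 = a3 -> wit a1 a2 a3 w -> w <= 4 * a1 ^+ 2 * (a1 + a3).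
Proof.
move=> h1 h2 /andP[h12 h23] hw [[t /andP[t0 t1] ht]|[_ ->]]; last by [].
have tt : 0 < t * (1 - t) by rewrite mulr_gt0 // subr_gt0.
rewrite -subr_ge0 -(pmulr_lge0 _ tt) mulrBl ht.
case: hw => e; subst a2.
  have -> : 4 * a1 ^+ 2 * (a1 + a3) * (t * (1 - t)) - (a1 + t * a1 + (1 - t) * a3) *
    (a1 - t * a1 + (1 - t) * a3) * (a1 + t * a1 - (1 - t) * a3) =
    (1 - t) ^+ 3 * ((a1 + a3) ^+ 2 * (a3 - a1)) by ring.
  by rewrite !mulr_ge0 ?exprn_ge0 //; lra.
have -> : 4 * a1 ^+ 2 * (a1 + a3) * (t * (1 - t)) - (a1 + t * a3 + (1 - t) * a3) *
    (a1 - t * a3 + (1 - t) * a3) * (a1 + t * a3 - (1 - t) * a3) =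
    (1 - 2 * t) ^+ 2 * ((a1 + a3) ^+ 2 * (a3 - a1)) by ring.
apply: mulr_ge0; first exact: sqr_ge0.
by apply: mulr_ge0; [exact: sqr_ge0|lra].
Qed.

Lemma Q_neg (a1 a2 a3 w : R) : 0 <= a1 -> 0 < a2 -> a1 <= a2 <= a3 ->
  wit a1 a2 a3 w -> 2 * (a1 + a2 + a3) - 1 < 4 * w -> Q a1 a2 a3 < 0.
Proof.
move=> h1 h2 h12 hw hk; case/andP: (h12); rewrite le_eqVlt => /orP[/eqP e12|l12] h23.
  apply: Q_wall_neg => //; [lra|by left|].
  by have := wit_wall h1 h2 h12 (or_introl e12) hw; lra.
move: h23; rewrite le_eqVlt => /orP[/eqP e23|l23]; last exact: Q_neg_inside hw hk.
apply: Q_wall_neg => //; [lra|by right|].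
by have := wit_wall h1 h2 h12 (or_intror e23) hw; lra.
Qed.

Lemma Q_le0 (a1 a2 a3 : R) : 0 <= a1 -> 0 < a2 -> a1 <= a2 <= a3 -> a2 + a3 <= 1 ->
  Q a1 a2 a3 <= 0 -> exists2 w, wit a1 a2 a3 w & 2 * (a1 + a2 + a3) - 1 <= 4 * w.
Proof.
move=> h1 h2 h12 hB hQ; case/andP: (h12); rewrite le_eqVlt => /orP[/eqP e12|l12] h23.
  exists (4 * a1 ^+ 2 * (a1 + a3)); first by right.
  have [l13|l13] := ltP a1 a3.
    rewrite leNgt; apply/negP => hlt.
    have : 0 < Q a1 a2 a3 by apply: Q_wall_pos => //; [by left|lra].
    by rewrite ltNge hQ.
  have -> : a2 = a1 by [].
  have -> : a3 = a1 by lra.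
  (* On the diagonal the claim reads 32 a1^3 - 6 a1 + 1 >= 0, factored here. *)
  have : 0 <= (4 * a1 - 1) ^+ 2 * (2 * a1 + 1) by rewrite mulr_ge0 ?sqr_ge0 //; lra.
  lra.
move: h23; rewrite le_eqVlt => /orP[/eqP e23|l23]; last exact: Q_le0_inside.
exists (4 * a1 ^+ 2 * (a1 + a3)).
  left; exists 2^-1; first by apply/andP; split; lra.
  by rewrite -e23; field.
rewrite leNgt; apply/negP => hlt.
have : 0 < Q a1 a2 a3 by apply: Q_wall_pos => //; [lra|by right|lra].
by rewrite ltNge hQ.
Qed.
End Witness.

(** * Sign of Q along segments *)

Section Bounds.
Variable R : realType.

(** The first factor in [wit] is positive and the other two, of positive product, sum to 2 a1 >= 0,
    so all are positive. Absorbing 1 - t and t into them turns w into a plain product, ready for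
    AM-GM. *)
Lemma wit_factors (a1 a2 a3 w : R) : 0 <= a1 -> 0 < a2 -> a1 <= a2 <= a3 ->
  wit a1 a2 a3 w -> 0 < w -> (exists t X Y Z,
    [/\ 0 < t < 1, w = X * Y * Z,
      [/\ 0 < X, 0 < Y & 0 < Z], X = a1 + t * a2 + (1 - t) * a3
      & (1 - t) * Y = a1 - t * a2 + (1 - t) * a3 /\ t * Z = a1 + t * a2 - (1 - t) * a3])
  \/ (a1 = a2 /\ w = 4 * a1 ^+ 2 * (a1 + a3)).
Proof.
move=> h1 h2 /andP[h12 h23] [[t /andP[t0 t1] hw]|]; last by right.
move=> w0; left.
have s0 : 0 < 1 - t by rewrite subr_gt0.
set X := a1 + t * a2 + (1 - t) * a3 in hw *.
set Y := a1 - t * a2 + (1 - t) * a3 in hw *.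
set Z := a1 + t * a2 - (1 - t) * a3 in hw *.
have X0 : 0 < X.
  have : 0 < t * a2 by rewrite mulr_gt0.
  have : 0 < (1 - t) * a3 by rewrite mulr_gt0 //; lra.
  rewrite /X; lra.
have P0 : 0 < X * Y * Z by rewrite -hw !mulr_gt0.
have YZ : 0 < Y * Z by rewrite -mulrA pmulr_rgt0 // in P0.
have Y0 : 0 < Y.
  rewrite ltNge; apply/negP => Y0.
  have : 0 <= (- Y) * (Y + Z) by rewrite mulr_ge0 ?oppr_ge0 // /Y /Z; lra.
  have : 0 <= Y ^+ 2 by exact: sqr_ge0.
  lra.
have Z0 : 0 < Z by rewrite -(pmulr_rgt0 _ Y0).
exists t, X, (Y / (1 - t)), (Z / t); split => //; first by rewrite t0.
- have -> : X * (Y / (1 - t)) * (Z / t) = X * Y * Z / (t * (1 - t)).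
    by field; apply/andP; split; apply/eqP; lra.
  by rewrite -hw mulfK // gt_eqF // mulr_gt0.
- by split=> //; rewrite divr_gt0.
- by split; rewrite mulrC divfK // gt_eqF.
Qed.

Lemma amgm3 (x y z : R) : 0 <= x -> 0 <= y -> 0 <= z ->
  27 * (x * y * z) <= (x + y + z) ^+ 3.
Proof.
move=> x0 y0 z0; rewrite -subr_ge0.
have -> : (x + y + z) ^+ 3 - 27 * (x * y * z) =
  (x + y + z) * ((x - y) ^+ 2 + (y - z) ^+ 2 + (z - x) ^+ 2) / 2
  + 3 * (x * (y - z) ^+ 2 + y * (z - x) ^+ 2 + z * (x - y) ^+ 2) by field.
have [a b c] := And3 (sqr_ge0 (x - y)) (sqr_ge0 (y - z)) (sqr_ge0 (z - x)).
have m1 := mulr_ge0 x0 b; have m2 := mulr_ge0 y0 c; have m3 := mulr_ge0 z0 a.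
have m4 : 0 <= (x + y + z) * ((x - y) ^+ 2 + (y - z) ^+ 2 + (z - x) ^+ 2).
  by apply: mulr_ge0; lra.
lra.
Qed.

(** By AM-GM the cube of the sum is at least 27/16. The constant 1/16 is 4 (1/8)^2, the bound
    available in [prod3_increase] and [prod3_increase_wall]. *)
Lemma sum_gt1 (x y z : R) : 0 <= x -> 0 <= y -> 0 <= z ->
  1 / 16 <= x * y * z -> 1 < x + y + z.
Proof.
move=> x0 y0 z0 h; rewrite ltNge; apply/negP => h1.
have := amgm3 x0 y0 z0.
have : (x + y + z) ^+ 3 <= 1 by rewrite exprn_ile1 // !addr_ge0.
lra.
Qed.

Lemma prod3_ge (x y z x' y' z' : R) : 0 <= x -> 0 <= y -> 0 <= z ->
  0 <= x' -> 0 <= y' -> 0 <= z' ->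
  x * y * z + (x' * (y * z) + y' * (x * z) + z' * (x * y)) <=
  (x + x') * (y + y') * (z + z').
Proof.
move=> x0 y0 z0 x0' y0' z0'; rewrite -subr_ge0.
have -> : (x + x') * (y + y') * (z + z') -
  (x * y * z + (x' * (y * z) + y' * (x * z) + z' * (x * y))) =
  x' * y' * z + x' * z' * y + y' * z' * x + x' * y' * z' by ring.
by rewrite !addr_ge0 // !mulr_ge0.
Qed.

(** AM-GM on the factors of [wit_factors], whose sum is at most 2 s1: the deficit times t (1 - t) is
    a nonnegative combination of a2 - a1 and a3 - a1, with positive coefficient at the latter. *)
Lemma wit_le (a1 a2 a3 w : R) : 0 <= a1 -> 0 < a2 -> a1 <= a2 <= a3 ->
  wit a1 a2 a3 w -> 27 * w <= 8 * (a1 + a2 + a3) ^+ 3 /\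
   (a1 < a3 -> 27 * w < 8 * (a1 + a2 + a3) ^+ 3).
Proof.
move=> h1 h2 h12 hw.
have sp : 0 < (a1 + a2 + a3) ^+ 3 by rewrite exprn_gt0 //; lra.
have [w0|w0] := leP w 0; first by split=> [|_]; lra.
have [x [y [z [x0 [y0 [z0 [-> [hs hs']]]]]]]] : exists x y z : R, [/\ 0 <= x, 0 <= y, 0 <= z &
  w = x * y * z /\ x + y + z <= 2 * (a1 + a2 + a3) /\ (a1 < a3 -> x + y + z < 2 * (a1 + a2 +
    a3))].
  case/andP: (h12) => h12' h23.
  case: (wit_factors h1 h2 h12 hw w0) => [[t [X [Y [Z [/andP[t0 t1] -> [X0 Y0 Z0] hX [hY
    hZ]]]]]]|[e ->]].
    exists X, Y, Z; split; [exact: ltW..|split=> //].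
    have s0 : 0 < 1 - t by rewrite subr_gt0.
    have tt : 0 < t * (1 - t) by rewrite mulr_gt0.
    have e : (2 * (a1 + a2 + a3) - (X + Y + Z)) * (t * (1 - t)) =
      (a2 - a1) * ((1 - t) ^+ 2 * t + t ^+ 2) + (a3 - a1) * (t ^+ 2 * (1 - t) + (1 - t) ^+ 2).
      have -> : (2 * (a1 + a2 + a3) - (X + Y + Z)) * (t * (1 - t)) =
        2 * (a1 + a2 + a3) * (t * (1 - t)) - X * (t * (1 - t)) - t * ((1 - t) * Y) - (1 - t) *
          (t * Z) by ring.
      by rewrite hY hZ hX; ring.
    have c1 : 0 <= (a2 - a1) * ((1 - t) ^+ 2 * t + t ^+ 2).
      by rewrite mulr_ge0 ?subr_ge0 // addr_ge0 ?sqr_ge0 // mulr_ge0 ?sqr_ge0 // ltW.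
    have c2 : 0 < t ^+ 2 * (1 - t) + (1 - t) ^+ 2.
      by rewrite addr_gt0 ?mulr_gt0 ?exprn_gt0.
    split=> [|h13].
      rewrite -subr_ge0 -(pmulr_lge0 _ tt) e; apply: addr_ge0 => //.
      by apply: mulr_ge0; [lra|exact: ltW].
    rewrite -subr_gt0 -(pmulr_lgt0 _ tt) e ltr_wpDl // mulr_gt0 // subr_gt0 //.
  exists (2 * a1), (2 * a1), (a1 + a3); split; lra.
have h := amgm3 x0 y0 z0.
have e : 8 * (a1 + a2 + a3) ^+ 3 = (2 * (a1 + a2 + a3)) ^+ 3 by ring.
rewrite e; split=> [|/hs' hlt]; [apply: le_trans h _ | apply: le_lt_trans h _].
  by rewrite lerXn2r ?nnegrE //; lra.
by rewrite ltrXn2r ?nnegrE //; lra.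
Qed.

Lemma wit_scale (l a1 a2 a3 w : R) : wit a1 a2 a3 w ->
  wit (l * a1) (l * a2) (l * a3) (l ^+ 3 * w).
Proof.
case=> [[t ht e]|[-> ->]]; [left; exists t => //|right; split=> //; ring].
by rewrite -mulrA e; ring.
Qed.

(** A witness w scales to l^3 w. If w > 0, the gap 4 l^3 w - (2 l s1 - 1) exceeds (1 - l) (2 s1 - 12
    w), and [wit_le] with s1 <= 3/4 gives 6 w <= s1. If w <= 0, then 2 s1 - 1 <= 0 as well and l^3
    <= l suffices. *)
Lemma Q_contract (l a1 a2 a3 : R) : 0 <= a1 -> 0 < a2 -> a1 <= a2 <= a3 ->
  a1 + a2 + a3 <= 3 / 4 -> Q a1 a2 a3 <= 0 -> 0 < l < 1 ->
  Q (l * a1) (l * a2) (l * a3) < 0.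
Proof.
move=> h1 h2 h12 hs hQ /andP[l0 l1]; case/andP: (h12) => h12' h23.
have [|w hw hk] := Q_le0 h1 h2 h12 _ hQ; first lra.
apply: (Q_neg _ _ _ (wit_scale l hw)).
- by rewrite mulr_ge0 // ltW.
- by rewrite mulr_gt0.
- by rewrite !ler_pM2l.
have [b _] := wit_le h1 h2 h12 hw.
have s0 : 0 < a1 + a2 + a3 by lra.
rewrite -!mulrDr mulrCA; set s := a1 + a2 + a3 in hs hk b s0 *.
have [w0|w0] := leP w 0.
  have : 0 <= (1 - l ^+ 2) * (l * - (2 * s - 1)).
    apply: mulr_ge0; first by rewrite subr_ge0 exprn_ile1 // ltW.
    by apply: mulr_ge0; lra.
  have : 0 <= l ^+ 3 * (4 * w - (2 * s - 1)).
    by apply: mulr_ge0; [rewrite exprn_ge0 // ltW|lra].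
  lra.
have s2 : 8 * s ^+ 3 <= 27 / 6 * s.
  have : 0 <= s * ((3 / 4 - s) * (3 / 4 + s)) by rewrite !mulr_ge0 //; lra.
  lra.
have : 0 < (1 - l) * (4 * w * (3 - 1 - l - l ^+ 2)).
  rewrite !mulr_gt0 ?subr_gt0 //.
  have : l ^+ 2 < 1 by rewrite exprn_ilt1 // ltW.
  lra.
have : 0 <= (1 - l) * (2 * s - 12 * w) by rewrite mulr_ge0 //; lra.
lra.
Qed.

(** From 4 w >= 2 s1 - 1 and s1 >= 3/4 follows 6 w >= s1, so 4 l^3 w outgrows 2 l s1 - 1 as l
    increases from 1. *)
Lemma Q_expand (l a1 a2 a3 : R) : 0 <= a1 -> 0 < a2 -> a1 <= a2 <= a3 ->
  a2 + a3 <= 1 -> 3 / 4 <= a1 + a2 + a3 -> Q a1 a2 a3 <= 0 -> 1 < l ->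
  Q (l * a1) (l * a2) (l * a3) < 0.
Proof.
move=> h1 h2 h12 hB hs hQ l1.
have l0 : 0 < l by lra.
have [w hw hk] := Q_le0 h1 h2 h12 hB hQ.
apply: (Q_neg _ _ _ (wit_scale l hw)).
- by rewrite mulr_ge0 // ltW.
- by rewrite mulr_gt0.
- by rewrite !ler_pM2l.
rewrite -!mulrDr mulrCA; set s := a1 + a2 + a3 in hs hk *.
have : 0 <= (l - 1) * (12 * w - 2 * s) by rewrite mulr_ge0 //; lra.
have : 0 < (l - 1) * (w * (l + l ^+ 2 - 2)).
  rewrite !mulr_gt0 ?subr_gt0 //; first lra.
  have : 1 < l ^+ 2 by rewrite exprn_egt1.
  lra.
lra.
Qed.

(** Q <= 0 would require a witness w >= 1/8, while the strict half of [wit_le] gives w < 1/8. *)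
Lemma Q_plane (a1 a2 a3 : R) : 0 <= a1 -> 0 < a2 -> a1 <= a2 <= a3 ->
  a1 + a2 + a3 = 3 / 4 -> a1 < a3 -> 0 < Q a1 a2 a3.
Proof.
move=> h1 h2 h12 hs h13; rewrite ltNge; apply/negP => hQ.
have [|w hw] := Q_le0 h1 h2 h12 _ hQ; first by lra.
have [_ /(_ h13)] := wit_le h1 h2 h12 hw.
rewrite hs; lra.
Qed.

(** A convex region of positive Q around the part of the face a3 = 1/2 below s1 = 3/4. It keeps
    zeros of Q inside the cube and offers a detour to rays that leave it. *)
Lemma Q_far (a1 a2 a3 : R) : 0 <= a1 -> 0 < a2 -> a1 <= a2 <= a3 ->
  a1 + a2 + a3 <= 3 / 4 -> 1 / 2 <= a3 + a1 / 4 -> 0 < Q a1 a2 a3.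
Proof.
move=> h1 h2 h12 hs h3; rewrite ltNge; apply/negP => hQ.
case/andP: (h12) => h12' h23.
have [|w hw hk] := Q_le0 h1 h2 h12 _ hQ; first by lra.
have [w0|w0] := leP w 0; first by lra.
have : w <= 2 * (a1 + a3) * (a1 + a2) ^+ 2.
  case: (wit_factors h1 h2 h12 hw w0) => [[t [X [Y [Z [/andP[t0 t1] -> [X0 Y0 Z0] hX [hY
    hZ]]]]]]|[-> ->]]; last first.
    have : 0 <= a2 ^+ 2 * (a2 + a3) by rewrite mulr_ge0 ?sqr_ge0 //; lra.
    lra.
  have s0 : 0 < 1 - t by rewrite subr_gt0.
  have YU : Y <= a1 + a3.
    rewrite -(ler_pM2l s0) hY.
    have : 0 <= t * (a2 - a1) by rewrite mulr_ge0 ?subr_ge0 // ltW.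
    lra.
  have ZU : Z <= a1 + a2.
    rewrite -(ler_pM2l t0) hZ.
    have : 0 <= (1 - t) * (a3 - a1) by apply: mulr_ge0; lra.
    lra.
  have XU : X <= 2 * (a1 + a2).
    have : 0 < t * Z by rewrite mulr_gt0.
    have : 0 <= (1 - t) * a2 by rewrite mulr_ge0 ?ltW.
    rewrite hZ hX; lra.
  have -> : 2 * (a1 + a3) * (a1 + a2) ^+ 2 = (2 * (a1 + a2)) * (a1 + a3) * (a1 + a2) by ring.
  by rewrite !ler_pM ?mulr_ge0 // ltW.
(* The hypotheses give a1 + a2 <= 2/7 and kappa >= 7/4 (a1 + a2), whereas 4 w <= 8 (3/4) (2/7) (a1 +
   a2) = 12/7 (a1 + a2). *)
have : 0 <= (a1 + a2) * (3 / 4 - (a1 + a3)) by rewrite mulr_ge0 //; lra.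
have : 0 <= (a1 + a2) * (2 / 7 - (a1 + a2)) by rewrite mulr_ge0 //; lra.
have : 0 <= (a1 + a2) * (2 / 7 - (a1 + a2)) * (a1 + a3).
  by rewrite !mulr_ge0 //; lra.
lra.
Qed.

Lemma Q_near0 (a1 a2 a3 : R) : 0 < a1 -> a1 <= a2 <= a3 ->
  a1 + a2 + a3 <= 1 / 2 -> Q a1 a2 a3 < 0.
Proof.
move=> h1 h12 hs; case/andP: (h12) => h12' h23.
have h23' : 0 < a2 + a3 by lra.
(* Chosen so that t a2 = (1 - t) a3: two factors become a1 and the witness is positive, while kappa
   <= 0. *)
pose t := a3 / (a2 + a3).
have e : t * (a2 + a3) = a3 by rewrite divfK // gt_eqF.
have t0 : 0 < t by rewrite divr_gt0 //; lra.
have t1 : 0 < 1 - t by rewrite subr_gt0 ltr_pdivrMr //; lra.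
pose w := (a1 + t * a2 + (1 - t) * a3) * a1 ^+ 2 / (t * (1 - t)).
have X0 : 0 < a1 + t * a2 + (1 - t) * a3.
  have : 0 < t * a2 by rewrite mulr_gt0 //; lra.
  have : 0 < (1 - t) * a3 by rewrite mulr_gt0 //; lra.
  lra.
have w0 : 0 < w by rewrite divr_gt0 // mulr_gt0 // exprn_gt0.
have hw : wit a1 a2 a3 w.
  left; exists t; first by rewrite t0 -subr_gt0.
  rewrite divfK ?(gt_eqF (mulr_gt0 t0 t1)) //.
  have -> : a1 - t * a2 + (1 - t) * a3 = a1 by lra.
  have -> : a1 + t * a2 - (1 - t) * a3 = a1 by lra.
  by ring.
have h2 : 0 < a2 by lra.
apply: (Q_neg (ltW h1) h2 h12 hw).
by move: (w) w0 => v v0; lra.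
Qed.

(** Since kappa > 0, a witness would have to be positive; but for a1 = 0 the last two factors sum to
    0 and cannot both be positive. *)
Lemma Q_facet (a2 a3 : R) : 0 < a2 -> a2 <= a3 -> a2 + a3 <= 1 ->
  1 / 2 < a2 + a3 -> 0 < Q 0 a2 a3.
Proof.
move=> h2 h23 hB hs; rewrite ltNge; apply/negP => hQ.
have h02 : 0 <= a2 <= a3 by rewrite ltW.
have [w hw hk] := Q_le0 (lexx 0) h2 h02 hB hQ.
have w0 : 0 < w by lra.
case: (wit_factors (lexx 0) h2 h02 hw w0) => [[t [X [Y [Z [/andP[t0 t1] _ [_ Y0 Z0] _ [hY
  hZ]]]]]]|[e]].
  have : 0 < (1 - t) * Y by rewrite mulr_gt0 // subr_gt0.
  have : 0 < t * Z by rewrite mulr_gt0.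
  lra.
by rewrite -e ltxx in h2.
Qed.

(** Moving the point by e (1, 0, 0) + d (1, 1, 0) raises 4 w by more than 2 s1. By [prod3_ge] the
    first-order terms suffice; the coefficients of e and d are sums of three terms of product at
    least 1/16, hence exceed 1. *)
Lemma prod3_increase (s X Y Z e d : R) : 0 < s < 1 -> 0 < X -> 0 < Y -> 0 < Z ->
  1 / 8 <= X * Y * Z -> 0 <= e -> 0 <= d -> 0 < e + d ->
  4 * (X * Y * Z) + 2 * (e + 2 * d) <
  4 * ((X + (e + d * (1 + s))) * (Y + (e / (1 - s) + d)) * (Z + (e / s + d * (1 + s) / s))).
Proof.
move=> /andP[s0 s1] X0 Y0 Z0 w8 e0 d0 ed0.
have [X1 Y1 Z1] := And3 (ltW X0) (ltW Y0) (ltW Z0).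
have r0 : 0 < 1 - s by rewrite subr_gt0.
have [sp rp] := (ltW s0, ltW r0).
have s1p : 0 <= 1 + s by rewrite addr_ge0.
have ss : 0 < s * (1 - s) by rewrite mulr_gt0.
have w2 : 1 / 64 <= (X * Y * Z) ^+ 2.
  have -> : 1 / 64 = (1 / 8) ^+ 2 :> R by field.
  by rewrite lerXn2r ?nnegrE ?divr_ge0 // !mulr_ge0.
have S1 : 1 < Y * Z + X * Z / (1 - s) + X * Y / s.
  apply: sum_gt1; rewrite ?divr_ge0 ?mulr_ge0 //.
  have -> : Y * Z * (X * Z / (1 - s)) * (X * Y / s) = (X * Y * Z) ^+ 2 / (s * (1 - s)).
    by field; rewrite !gt_eqF.
  rewrite ler_pdivlMr //; apply: le_trans _ w2.
  have := sqr_ge0 (2 * s - 1); clear; lra.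
have S2 : 1 < (1 + s) * (Y * Z) + X * Z + (1 + s) * (X * Y) / s.
  apply: sum_gt1; rewrite ?divr_ge0 ?mulr_ge0 //.
  have -> : (1 + s) * (Y * Z) * (X * Z) * ((1 + s) * (X * Y) / s) = (X * Y * Z) ^+ 2 * (1 + s)
    ^+ 2 / s.
    by field; rewrite gt_eqF.
  rewrite ler_pdivlMr //.
  apply: (@le_trans _ _ (1 / 64 * (1 + s) ^+ 2)); last by rewrite ler_wpM2r ?sqr_ge0.
  have := sqr_ge0 (s - 1); clear; lra.
have x0 : 0 <= e + d * (1 + s) by rewrite addr_ge0 // mulr_ge0.
have y0 : 0 <= e / (1 - s) + d by rewrite addr_ge0 // divr_ge0.
have z0 : 0 <= e / s + d * (1 + s) / s by rewrite addr_ge0 // divr_ge0 // mulr_ge0.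
apply: lt_le_trans (_ : 4 * (X * Y * Z +
   (e * (Y * Z + X * Z / (1 - s) + X * Y / s)
       + d * ((1 + s) * (Y * Z) + X * Z + (1 + s) * (X * Y) / s))) <= _); last first.
  rewrite ler_pM2l //; apply: le_trans _ (prod3_ge X1 Y1 Z1 x0 y0 z0).
  rewrite le_eqVlt; apply/orP; left; apply/eqP.
  by field; rewrite !gt_eqF.
rewrite [ltRHS]mulrDr ltrD2l.
move: (Y * Z + _ + _) (_ * (Y * Z) + _ + _) S1 S2 => S S' S1 S2.
have m1 : 0 <= e * (S - 1) by rewrite mulr_ge0 // subr_ge0 ltW.
have [dp|dn] := ltP 0 d; last first.
  have -> : d = 0 by apply/eqP; rewrite eq_le dn d0.
  by move: dn; clear -m1 e0 ed0; lra.
have m2 : 0 < d * (S' - 1) by rewrite mulr_gt0 // subr_gt0.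
clear -m1 m2 e0; lra.
Qed.

Lemma prod3_increase_wall (a b d : R) : 0 <= a -> 0 <= b -> 1 / 8 <= 4 * a ^+ 2 * b -> 0 < d ->
  4 * (4 * a ^+ 2 * b) + 4 * d < 4 * (4 * (a + d) ^+ 2 * (b + d)).
Proof.
move=> a0 b0 w8 d0.
have x0 : 0 <= 2 * d by rewrite mulr_ge0 // ltW.
have X0 : 0 <= 2 * a by rewrite mulr_ge0.
have S : 1 < 2 * (b * (2 * a)) + (2 * a) * (2 * a) + 2 * ((2 * a) * b).
  apply: sum_gt1; rewrite ?mulr_ge0 //.
  have -> : 2 * (b * (2 * a)) * (2 * a * (2 * a)) * (2 * (2 * a * b))
     = 4 * (4 * a ^+ 2 * b) ^+ 2 by ring.
  have -> : 1 / 16 = 4 * (1 / 8) ^+ 2 :> R by field.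
  by rewrite ler_pM2l // lerXn2r ?nnegrE ?divr_ge0 ?mulr_ge0 ?sqr_ge0.
have := prod3_ge X0 b0 X0 x0 (ltW d0) x0.
have : 0 < d * (2 * (b * (2 * a)) + (2 * a) * (2 * a) + 2 * ((2 * a) * b) - 1).
  by rewrite mulr_gt0 // subr_gt0.
clear -d0; lra.
Qed.

(* The vector (a3 - a1, a3 - a2, 0) is a nonnegative combination of (1, 0, 0) and (1, 1, 0),
   and the witness grows fast enough in both directions. *)
Lemma Q_to_diag (t a1 a2 a3 : R) : 0 <= a1 -> 0 < a2 -> a1 <= a2 <= a3 ->
  a2 + a3 <= 1 -> a1 < a3 -> 3 / 4 <= a1 + a2 + a3 -> Q a1 a2 a3 <= 0 -> 0 < t <= 1 ->
  Q (lerp t a1 a3) (lerp t a2 a3) a3 < 0.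
Proof.
move=> h1 h2 h12 hB h13 hs hQ /andP[t0 t1]; case/andP: (h12) => h12' h23.
have [w hw hk] := Q_le0 h1 h2 h12 hB hQ.
have w8 : 1 / 8 <= w by clear -hs hk; lra.
have w0 : 0 < w by clear -w8; lra.
pose e := t * (a2 - a1); pose d := t * (a3 - a2).
have e0 : 0 <= e by rewrite mulr_ge0 ?subr_ge0 // ltW.
have d0 : 0 <= d by rewrite mulr_ge0 ?subr_ge0 // ltW.
have ed0 : 0 < e + d by rewrite -mulrDr mulr_gt0 // addrC subrKA subr_gt0.
have ht : 0 <= t <= 1 by rewrite ltW.
have ha1 : 0 <= lerp t a1 a3 by rewrite le_lerp // ltW // (le_lt_trans h1).
have ha2 : 0 < lerp t a2 a3 by rewrite lt_lerp // (lt_le_trans h2).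
have ha12 : lerp t a1 a3 <= lerp t a2 a3 <= a3 by rewrite ler_lerp // lerp_le.
have e1 : lerp t a1 a3 = a1 + e + d by rewrite /lerp /e /d; ring.
have e2 : lerp t a2 a3 = a2 + d by [].
have e00 : a1 = a2 -> e = 0 by move=> h; rewrite /e h subrr mulr0.
rewrite e1 e2 in ha1 ha2 ha12 *; clearbody e d.
clear hQ t t0 t1 ht e1 e2.
case: (wit_factors h1 h2 h12 hw w0) => [[s [X [Y [Z [hs1 ew [X0 Y0 Z0] hX [hY hZ]]]]]]|[ew ew']].
  case/andP: (hs1) => s0 s1.
  have H := prod3_increase hs1 X0 Y0 Z0; rewrite -ew in H.
  move: {H}(H _ _ w8 e0 d0 ed0).
  set W := _ * _ * (Z + _) => HW.
  apply: (@Q_neg _ _ _ _ W) => //; last by clear -HW hk; lra.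
  (* The parameter of the old witness is kept while the point moves. *)
  left; exists s => //.
  have -> : W * (s * (1 - s)) = (X + (e + d * (1 + s))) * ((1 - s) * Y + e + d * (1 - s))
     * (s * Z + e + d * (1 + s)).
    by rewrite /W; clear -s0 s1; field; apply/andP; split; apply/eqP; lra.
  by rewrite hX hY hZ; clear; ring.
have b0 : 0 <= a1 + a3 by rewrite addr_ge0 // (le_trans h1) // ltW.
rewrite (e00 ew) add0r addr0 in ed0 ha1 ha12 *.
have w8' : 1 / 8 <= 4 * a1 ^+ 2 * (a1 + a3) by rewrite -ew'.
have := prod3_increase_wall h1 b0 w8' ed0; rewrite -ew' (addrAC a1 a3 d) => HW.
apply: (Q_neg ha1 ha2 ha12); first by right; split=> //; rewrite ew.
clear -HW hk ew; lra.
Qed.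
End Bounds.

(** * Paths *)

Section Paths.
Variable R : realType.

Definition pt (x y z : R) : 'rV[R]_3 := \row_i [:: x; y; z]`_i.

Lemma ptE (x y z : R) :
  (pt x y z 0 0 = x) * (pt x y z 0 1 = y) * (pt x y z 0 2 = z).
Proof. by rewrite !mxE. Qed.

Lemma pt_eta (a : 'rV[R]_3) : a = pt (a 0 0) (a 0 1) (a 0 2).
Proof.
apply/rowP => i; rewrite mxE; case: i => [[|[|[|//]]] hi] /=;
  by congr (a _ _); apply: val_inj.
Qed.

Lemma cvg_pt (T : Type) (F : set_system T) (FF : Filter F) (f g h : T -> R) (x y z : R) :
  f @ F --> x -> g @ F --> y -> h @ F --> z ->
  (fun t => pt (f t) (g t) (h t)) @ F --> pt x y z.
Proof.
move=> fx gy hz B [P hP sPB].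
have h0 : F (f @^-1` P 0 0) := fx _ (eq_rect _ (fun u => nbhs u (P 0 0)) (hP 0 0) _ (ptE x y
  z).1.1).
have h1 : F (g @^-1` P 0 1) := gy _ (eq_rect _ (fun u => nbhs u (P 0 1)) (hP 0 1) _ (ptE x y
  z).1.2).
have h2 : F (h @^-1` P 0 2) := hz _ (eq_rect _ (fun u => nbhs u (P 0 2)) (hP 0 2) _ (ptE x y
  z).2).
suff: F ((fun t => pt (f t) (g t) (h t)) @^-1` B) by [].
apply: filterS (filterI h0 (filterI h1 h2)) => t [t0 [t1 t2]]; apply: sPB => i j.
rewrite (ord1 i) mxE; case: j => [[|[|[|//]]] hj] /=.
- by have -> : Ordinal hj = 0 by exact: val_inj.
- by have -> : Ordinal hj = 1 by exact: val_inj.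
- by have -> : Ordinal hj = 2 by exact: val_inj.
Qed.

Lemma cvg_expn (T : Type) (F : set_system T) (FF : Filter F) (f : T -> R) (x : R) n :
  f @ F --> x -> (fun t => f t ^+ n) @ F --> x ^+ n.
Proof.
move=> fx; elim: n => [|n IH]; first exact: cvg_cst.
under eq_fun do rewrite exprS.
by rewrite exprS; exact: cvgM.
Qed.

End Paths.

Ltac cvg_poly := repeat lazymatch goal with
  | |- context [fun t => @?A t - @?B t] => apply: cvgB
  | |- context [fun t => @?A t + @?B t] => apply: cvgD
  | |- context [fun t => @?A t * @?B t] => apply: cvgM
  | |- context [fun t => @?A t ^+ _] => apply: cvg_expn
  | |- context [fun t => t] => exact: cvg_id
  | |- context [fun _ => ?c] => exact: cvg_cst
  | |- _ => assumption
  end.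

Section QPaths.
Variable R : realType.

Lemma cvg_Q (T : Type) (F : set_system T) (FF : Filter F) (f g h : T -> R) (x y z : R) :
  f @ F --> x -> g @ F --> y -> h @ F --> z ->
  (fun t => Q (f t) (g t) (h t)) @ F --> Q x y z.
Proof.
move=> fx gy hz; rewrite /Q /=.
cvg_poly.
Qed.

Lemma component_path (T : topologicalType) (A : set T) (g : R -> T) :
  {within `[0, 1], continuous g} -> (forall t, 0 <= t <= 1 -> A (g t)) ->
  connected_component A (g 0) (g 1).
Proof.
move=> gc gA.
have gA' : g @` `[0, 1] `<=` A by move=> _ [t + <-]; rewrite /= in_itv /= => /gA.
have h0 : (g @` `[0, 1]) (g 0) by exists 0; rewrite //= in_itv /= lexx ler01.
apply: (connected_component_max h0 gA').
  by apply: connected_continuous_connected gc; exact: segment_connected.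
by exists 1; rewrite //= in_itv /= lexx ler01.
Qed.

Lemma component_segment (A : set 'rV[R]_3) (x y z x' y' z' : R) :
  (forall t, 0 <= t <= 1 -> A (pt (lerp t x x') (lerp t y y') (lerp t z z'))) ->
  connected_component A (pt x y z) (pt x' y' z').
Proof.
move=> hA; pose g (t : R) := pt (lerp t x x') (lerp t y y') (lerp t z z').
have -> : pt x y z = g 0 by rewrite /g !lerp0.
have -> : pt x' y' z' = g 1 by rewrite /g !lerp1.
apply: component_path => //; apply: continuous_subspaceT => t.
by apply: cvg_pt; rewrite /lerp; cvg_poly.
Qed.

(** An implicit function theorem without derivatives. The last hypothesis makes each f t change sign
    once, from negative to positive, so its zero is unique; the signs just below and above the zero
    persist for nearby t, whence continuity. *)
Lemma zero_path (D : set R) (f : R -> R -> R) (M : R -> R) :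
  (forall l, continuous (f^~ l)) -> (forall t, continuous (f t)) -> continuous M ->
  (forall t, D t -> 0 <= M t) ->
  (forall t, D t -> f t 0 <= 0) -> (forall t, D t -> 0 <= f t (M t)) ->
  (forall t l l', D t -> 0 <= l' < l -> l <= M t -> f t l <= 0 -> f t l' < 0) ->
  exists2 r : R -> R, {within D, continuous r} &
    forall t, D t -> 0 <= r t <= M t /\ forall l, 0 <= l <= M t -> (f t l == 0) = (l == r t).
Proof.
move=> fl ft Mc M0 f0 fM H.
have zero t : D t -> exists l, 0 <= l <= M t /\ f t l = 0.
  move=> Dt; have [||l] := @IVT R (f t) 0 (M t) 0 (M0 t Dt).
  - by apply: continuous_subspaceT; exact: ft.
  - by rewrite ge_min f0 //= le_max fM ?orbT.
  by rewrite in_itv /= => hl fl0; exists l.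
have /choice[r hr] : forall t, exists l, D t -> 0 <= l <= M t /\ f t l = 0.
  move=> t; have [Dt|nD] := pselect (D t).
    by have [l hl] := zero t Dt; exists l.
  by exists 0.
have below t l : D t -> 0 <= l < r t -> f t l < 0.
  move=> Dt hl; have [/andP[_ r1] r2] := hr t Dt.
  by apply: (H t (r t)) => //; rewrite r2.
have above t l : D t -> r t < l <= M t -> 0 < f t l.
  move=> Dt /andP[l1 l2]; have [/andP[r0 _] r2] := hr t Dt.
  rewrite ltNge; apply/negP => fl0.
  by have := H t l (r t) Dt; rewrite r0 l1 r2 ltxx => /(_ isT l2 fl0).
exists r; last first.
  move=> t Dt; have [r1 r2] := hr t Dt; split=> // l /andP[l0 l1].
  apply/eqP/eqP => [fl0|-> //]; apply/eqP; rewrite eq_le !leNgt.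
  apply/andP; split; apply/negP => lr.
    by have := above t l Dt; rewrite lr l1 fl0 ltxx => /(_ isT).
  by have := below t l Dt; rewrite lr l0 fl0 ltxx => /(_ isT).
apply/subspace_continuousP => t0 Dt0.
apply/cvgrPdist_le => e e0.
have [/andP[r0 rM] _] := hr t0 Dt0.
have lower : \forall t \near t0, D t -> r t0 - e <= r t.
  (* A level below 0 bounds r trivially; otherwise f is negative at this level for t0 and, by
     continuity in t, nearby. *)
  have [re|re] := ltP (r t0 - e) 0.
    by near=> t => Dt; have [/andP[+ _] _] := hr t Dt; lra.
  have c1 : f t0 (r t0 - e) < 0 by apply: below => //; rewrite re /=; lra.
  have c2 : r t0 - e < M t0 by lra.
  have n1 := cvgr_lt _ (fl (r t0 - e) t0) _ c1.
  have n2 := cvgr_gt _ (Mc t0) _ c2.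
  near=> t => Dt; rewrite leNgt; apply/negP => rt.
  have n1t : f t (r t0 - e) < 0 by near: t; exact: n1.
  have n2t : r t0 - e < M t by near: t; exact: n2.
  have : 0 < f t (r t0 - e) by apply: above => //; rewrite rt ltW.
  lra.
have upper : \forall t \near t0, D t -> r t <= r t0 + e.
  have [re|re] := ltP (M t0) (r t0 + e).
    have n2 := cvgr_lt _ (Mc t0) _ re.
    near=> t => Dt; have [/andP[_ rt] _] := hr t Dt; apply: le_trans rt (ltW _).
    by near: t; exact: n2.
  have c1 : 0 < f t0 (r t0 + e) by apply: above => //; rewrite re andbT; lra.
  have n1 := cvgr_gt _ (fl (r t0 + e) t0) _ c1.
  near=> t => Dt; rewrite leNgt; apply/negP => rt.
  have n1t : 0 < f t (r t0 + e) by near: t; exact: n1.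
  have : f t (r t0 + e) < 0 by apply: below => //; rewrite rt andbT; lra.
  lra.
rewrite near_withinE; apply: filterS2 lower upper => t tl tu Dt.
suff : `|r t0 - r t| <= e by [].
by have := tl Dt; have := tu Dt => h1 h2; rewrite ler_norml; apply/andP; split; lra.
Unshelve. all: by end_near.
Qed.
End QPaths.

(** * The surface *)

Section Surface.
Variable R : realType.

Lemma open_cube_pt (x y z : R) : open_cube R (pt x y z) <->
  [/\ 0 < x < 1 / 2, 0 < y < 1 / 2 & 0 < z < 1 / 2].
Proof.
split=> [h|[hx hy hz] i]; first by have := h 0; have := h 1; have := h 2; rewrite !ptE.
rewrite mxE; case: i => [[|[|[|//]]] ?] /=; [exact: hx|exact: hy|exact: hz].
Qed.

Lemma Omega_pt (x y z : R) : Omega R (pt x y z) <-> Q x y z = 0.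
Proof. by rewrite /Omega /= !ptE. Qed.

Lemma chamber_ind (P : R -> R -> R -> Prop) :
  (forall x y z, P x y z -> P y x z) -> (forall x y z, P x y z -> P x z y) ->
  (forall x y z, x <= y <= z -> P x y z) -> forall x y z, P x y z.
Proof.
move=> s12 s23 H x y z.
case: (lerP x y) => xy; case: (lerP y z) => yz; case: (lerP x z) => xz.
- by apply: H; rewrite xy.
- by apply: H; rewrite xy.
- by apply/s23; apply: H; rewrite xz ltW.
- by apply/s23; apply/s12; apply: H; rewrite xy ltW.
- by apply/s12; apply: H; rewrite xz ltW.
- by apply/s12; apply/s23; apply: H; rewrite yz ltW.
- by apply/s12; apply/s23; apply/s12; apply: H; rewrite !ltW.
- by apply/s12; apply/s23; apply/s12; apply: H; rewrite !ltW.
Qed.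

Lemma component_map (T : topologicalType) (A : set T) (f : T -> T) (a b : T) :
  continuous f -> (forall x, A x -> A (f x)) ->
  connected_component A a b -> connected_component A (f a) (f b).
Proof.
move=> fc fA [C [Ca CA Cc] Cb]; exists (f @` C); last by exists b.
split; [by exists a|by move=> _ [x Cx <-]; apply: fA; exact: CA|].
by apply: connected_continuous_connected => //; exact: continuous_subspaceT.
Qed.

Lemma rV_coord_continuous (j : 'I_3) : continuous (fun a : 'rV[R]_3 => a 0 j).
Proof. exact: coord_continuous. Qed.

(** The two adjacent transpositions generate all permutations of the coordinates. *)
Definition symmetric_set (A : set 'rV[R]_3) := forall x y z,
  A (pt x y z) -> A (pt y x z) /\ A (pt x z y).

Lemma component_swap (A : set 'rV[R]_3) (x y z x' y' z' : R) : symmetric_set A ->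
  connected_component A (pt x y z) (pt x' y' z') ->
  connected_component A (pt y x z) (pt y' x' z') /\
  connected_component A (pt x z y) (pt x' z' y').
Proof.
move=> sA h; split.
  have := @component_map _ A (fun a => pt (a 0 1) (a 0 0) (a 0 2)) (pt x y z) (pt x' y' z').
  rewrite !ptE; apply=> //.
    move=> a.
    exact (cvg_pt _ (@rV_coord_continuous 1 a) (@rV_coord_continuous 0 a) (@rV_coord_continuous
      2 a)).
  by move=> a; rewrite {1}(pt_eta a) => /sA[].
have := @component_map _ A (fun a => pt (a 0 0) (a 0 2) (a 0 1)) (pt x y z) (pt x' y' z').
rewrite !ptE; apply=> //.
  move=> a.
  exact (cvg_pt _ (@rV_coord_continuous 0 a) (@rV_coord_continuous 2 a) (@rV_coord_continuous 1
    a)).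
by move=> a; rewrite {1}(pt_eta a) => /sA[].
Qed.

Lemma symmetric_cube : symmetric_set (open_cube R).
Proof. by move=> x y z /open_cube_pt[hx hy hz]; split; apply/open_cube_pt. Qed.

Lemma symmetric_Omega : symmetric_set (Omega R).
Proof.
by move=> x y z /Omega_pt h; split; apply/Omega_pt; [rewrite Q_swap12|rewrite Q_swap23].
Qed.

Lemma symmetric_setI : symmetric_set (open_cube R `&` Omega R).
Proof.
move=> x y z [/symmetric_cube[? ?] /symmetric_Omega[? ?]].
by split; split.
Qed.

Lemma symmetric_setD : symmetric_set (open_cube R `\` Omega R).
Proof.
move=> x y z [/symmetric_cube[c1 c2] no].
by split; split => //; contradict no; case/symmetric_Omega: no.
Qed.

Lemma Q_diag (b : R) : Q b b b = - ((4 * b - 1) ^+ 2 * (2 * b + 1)) ^+ 4.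
Proof. rewrite Q_pair; ring. Qed.

Lemma Q_center : Q (1 / 4) (1 / 4) (1 / 4) = 0 :> R.
Proof.
rewrite Q_diag; have -> : 4 * (1 / 4) - 1 = 0 :> R by field.
by rewrite expr0n mul0r expr0n oppr0.
Qed.

Lemma ordered_cube (x y z : R) : 0 < x -> x <= y <= z -> z < 1 / 2 ->
  open_cube R (pt x y z).
Proof. by move=> x0 /andP[xy yz] z1; apply/open_cube_pt; split; apply/andP; split; lra. Qed.

(* The ray from the origin through the point turns towards the diagonal, and the zero of Q
   on it moves continuously to the centre. *)
Lemma lower_sheet (a1 a2 a3 : R) : 0 < a1 -> a1 <= a2 <= a3 ->
  a1 + a2 + a3 <= 3 / 4 -> Q a1 a2 a3 = 0 ->
  connected_component (open_cube R `&` Omega R) (pt a1 a2 a3) (pt (1 / 4) (1 / 4) (1 / 4)).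
Proof.
move=> h1 /andP[h12 h23] hs hQ.
set s := a1 + a2 + a3 in hs.
have s0 : 0 < s by rewrite /s; lra.
(* Directions are normalised to coordinate sum 1, so the parameter l along a ray is s1 itself and
   ranges over [0, 3/4]. *)
pose d (a t : R) := lerp t (a / s) (1 / 3).
have dle a b t : a <= b -> 0 <= t <= 1 -> d a t <= d b t.
  by move=> ab ht; rewrite ler_lerp // ler_pM2r // invr_gt0.
have dpos t : 0 <= t <= 1 -> 0 < d a1 t by move=> ht; rewrite lt_lerp // divr_gt0.
have dsum t : d a1 t + d a2 t + d a3 t = 1.
  rewrite /d !lerpD.
  have -> : a1 / s + a2 / s + a3 / s = 1 by rewrite -!mulrDl -/s divff // gt_eqF.
  have -> : 1 / 3 + 1 / 3 + 1 / 3 = 1 :> R by field.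
  exact: lerpp.
have ds (l t : R) : l * d a1 t + l * d a2 t + l * d a3 t = l by rewrite -!mulrDr dsum mulr1.
have d0 a : s * d a 0 = a by rewrite /d lerp0 mulrC divfK // gt_eqF.
have d1 a : 3 / 4 * d a 1 = 1 / 4 by rewrite /d lerp1; field.
pose f (t l : R) := Q (l * d a1 t) (l * d a2 t) (l * d a3 t).
have f0 t : f t 0 < 0 by rewrite /f !mul0r /Q; clear; lra.
have D01 (t : R) : [set` `[0, 1]] t -> 0 <= t <= 1 by rewrite /= in_itv.
clearbody s.
have ord t l : 0 <= t <= 1 -> 0 < l ->
    [/\ 0 < l * d a1 t, l * d a1 t <= l * d a2 t <= l * d a3 t & 0 < l * d a2 t].
  move=> ht l0; have p1 := dpos t ht; have p12 := dle _ _ t h12 ht.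
  by rewrite !ler_pM2l // p12 dle // !mulr_gt0 // (lt_le_trans p1).
have q4 : 0 < 3 / 4 :> R by rewrite divr_gt0.
have [||||||| r rc hr] := @zero_path R [set` `[0, 1]] f (fun=> 3 / 4).
- by move=> l t; apply: cvg_Q; rewrite /d /lerp; cvg_poly.
- by move=> t l; apply: cvg_Q; cvg_poly.
- by move=> t; exact: cvg_cst.
- by move=> t _; exact: ltW.
- by move=> t _; exact: ltW.
- move=> t /D01 ht; have [/ltW p1 p12 p2] := ord t (3 / 4) ht q4.
  (* The diagonal ray meets the plane at the centre, where Q = 0; on any other ray [Q_plane]
     applies. *)
  have [e|ne] := eqVneq (3 / 4 * d a1 t) (3 / 4 * d a3 t).
    have := ds (3 / 4) t; move: p12; rewrite /f -e; clear.
    move: (_ * d a1 t) (_ * d a2 t) => x y /andP[xy yx] hs.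
    have -> : y = x by apply/eqP; rewrite eq_le xy yx.
    by have -> : x = 1 / 4; [lra|rewrite Q_center].
  apply/ltW/Q_plane => //; rewrite lt_neqAle ne.
  by case/andP: p12 => /le_trans; apply.
- move=> t l l' /D01 ht /andP[l'0 ll'] lM fl.
  have [->|l'n] := eqVneq l' 0; first exact: f0.
  have l'p : 0 < l' by rewrite lt_neqAle eq_sym l'n.
  have lp := lt_trans l'p ll'.
  have e x : l' * x = l' / l * (l * x) by rewrite mulrA divfK // gt_eqF.
  have [/ltW p1 p12 p2] := ord t l ht lp.
  rewrite /f !(e (d _ _)); apply: Q_contract => //; first by rewrite ds.
  by rewrite divr_gt0 //= ltr_pdivrMr // mul1r.
have mem t : 0 <= t <= 1 ->
    (open_cube R `&` Omega R) (pt (r t * d a1 t) (r t * d a2 t) (r t * d a3 t)).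
  move=> ht; have [|/andP[r0 rM] hr'] := hr t; first by rewrite /= in_itv.
  have /eqP fr : f t (r t) == 0 by rewrite hr' ?eqxx // r0.
  have rp : 0 < r t.
    by rewrite lt_neqAle r0 andbT; apply/eqP => e; have := f0 t; rewrite [in f _ _]e fr ltxx.
  have [p1 p12 p2] := ord t (r t) ht rp.
  split; last exact/Omega_pt.
  (* A zero with last coordinate at least 1/2 would contradict [Q_far]. *)
  apply: ordered_cube => //; rewrite ltNge; apply/negP => h.
  have : 0 < f t (r t); last by rewrite fr ltxx.
  apply: Q_far; rewrite ?ds //; first exact: ltW.
  by rewrite ler_wpDr // divr_ge0 // ltW.
have r0 : r 0 = s.
  have [|_ hr'] := hr 0; first by rewrite /= in_itv /= lexx ler01.
  by apply/esym/eqP; rewrite -hr' ?hs ?ltW // /f !d0 hQ.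
have r1 : r 1 = 3 / 4.
  have [|_ hr'] := hr 1; first by rewrite /= in_itv /= lexx ler01.
  by apply/esym/eqP; rewrite -hr' ?lexx ?ltW // /f !d1 Q_center.
pose g t := pt (r t * d a1 t) (r t * d a2 t) (r t * d a3 t).
have -> : pt a1 a2 a3 = g 0 by rewrite /g r0 !d0.
have -> : pt (1 / 4) (1 / 4) (1 / 4) = g 1 by rewrite /g r1 !d1.
apply: component_path => //.
have dc a : {within [set` `[0, 1]], continuous (d a)}.
  by apply: continuous_subspaceT => t; rewrite /d /lerp; cvg_poly.
move=> t; apply: cvg_pt; apply: cvgM; [exact: rc|exact: dc|exact: rc|exact: dc
  |exact: rc|exact: dc].
Qed.
End Surface.

Section SurfaceConnected.
Variable R : realType.

(** The upper bounds on l say that (b - l, b - th * l, b) has nonnegative first coordinate and s1 >=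
    3/4. *)
Lemma upper_sheet_geometry (b l th : R) : 0 <= th <= 1 -> b < 1 / 2 -> 0 <= l <= b ->
  l * (1 + th) <= 3 * b - 3 / 4 ->
  [/\ 0 <= b - l, 0 < b - th * l, b - l <= b - th * l <= b, b - th * l + b <= 1 &
      3 / 4 <= (b - l) + (b - th * l) + b].
Proof.
move=> /andP[th0 th1] b1 /andP[l0 lb] hl.
have m1 : 0 <= th * l by rewrite mulr_ge0.
have m2 : 0 <= (1 - th) * l by rewrite mulr_ge0 // subr_ge0.
by split; [| |apply/andP; split| |]; lra.
Qed.

(* Writes the point as (b - l, b - th * l, b) and lets b decrease to 1/4 with th fixed. *)
Lemma upper_sheet (a1 a2 a3 : R) : 0 < a1 -> a1 <= a2 <= a3 -> a3 < 1 / 2 ->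
  3 / 4 <= a1 + a2 + a3 -> Q a1 a2 a3 = 0 ->
  connected_component (open_cube R `&` Omega R) (pt a1 a2 a3) (pt (1 / 4) (1 / 4) (1 / 4)).
Proof.
move=> h1 h12 h3 hs hQ; case/andP: (h12) => h12' h23.
(* On the positive diagonal Q vanishes only at the centre, and the ratio [th] below would be 0 /
   0. *)
have [e|h13] := eqVneq a1 a3.
  have e2 : a2 = a1 by lra.
  have e4 : a1 = 1 / 4.
    move: hQ; rewrite -e e2 Q_diag => /eqP; rewrite oppr_eq0 expf_eq0 /= mulf_eq0.
    rewrite expf_eq0 /= => /orP[] /eqP; lra.
  rewrite -e e2 e4; apply: connected_component_refl; split.
    by apply: ordered_cube; rewrite ?lexx //; lra.
  exact/Omega_pt/Q_center.
have {}h13 : a1 < a3 by rewrite lt_neqAle h13 (le_trans h12').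
pose th := (a3 - a2) / (a3 - a1).
have th0 : 0 <= th by rewrite divr_ge0 // subr_ge0 // ltW.
have th1 : th <= 1 by rewrite ler_pdivrMr ?subr_gt0 // mul1r lerD2l lerN2.
have eth : th * (a3 - a1) = a3 - a2 by rewrite divfK // gt_eqF // subr_gt0.
have hth : 0 <= th <= 1 by rewrite th0.
have thp : 0 < 1 + th by rewrite ltr_pwDl.
clearbody th.
pose b (t : R) := lerp t a3 (1 / 4).
(* The segment leaving the diagonal stops at the plane s1 = 3/4 or at the facet where the first
   coordinate is 0, whichever comes first. *)
pose M (t : R) := Num.min ((3 * b t - 3 / 4) / (1 + th)) (b t).
pose f (t l : R) := Q (b t - l) (b t - th * l) (b t).
have b0 : b 0 = a3 by rewrite /b lerp0.
have b1 : b 1 = 1 / 4 by rewrite /b lerp1.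
have D01 (t : R) : [set` `[0, 1]] t -> 0 <= t <= 1 by rewrite /= in_itv.
have bl t : 0 <= t <= 1 -> 1 / 4 <= b t by move=> ht; apply: le_lerp => //; lra.
have bu t : 0 <= t <= 1 -> b t < 1 / 2 by move=> ht; apply: lerp_lt => //; lra.
have bc : continuous b by move=> t; rewrite /b /lerp; cvg_poly.
clearbody b.
have M0 t : 0 <= t <= 1 -> 0 <= M t.
  move=> /bl bt; rewrite le_min divr_ge0 ?(ltW thp) //; last by clear -bt; lra.
  by clear -bt; lra.
have geom t l : 0 <= t <= 1 -> 0 <= l <= M t ->
  [/\ 0 <= b t - l, 0 < b t - th * l, b t - l <= b t - th * l <= b t,
      b t - th * l + b t <= 1 & 3 / 4 <= (b t - l) + (b t - th * l) + b t].
  move=> ht /andP[l0]; rewrite le_min ler_pdivlMr // => /andP[l1 l2].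
  by apply: upper_sheet_geometry; rewrite ?bu // l0.
have facet t : 0 <= t <= 1 -> b t <= M t -> 0 < f t (b t).
  move=> ht hM; have bt := bl t ht.
  have bt0 : 0 <= b t by rewrite (le_trans _ bt) // divr_ge0.
  have [|_ g2 /andP[_ g3] g5 g4] := geom t (b t) ht; first by rewrite bt0.
  rewrite /f; rewrite subrr add0r in g4 *; apply: Q_facet => //.
  by apply: lt_le_trans g4; clear; lra.
have [||||||| r rc hr] := @zero_path R [set` `[0, 1]] f M.
- move=> l t; apply: (@cvg_Q _ _ (nbhs (t : R)));
    [apply: cvgB|apply: cvgB|]; first [exact: bc|exact: cvg_cst].
- move=> t l; apply: (@cvg_Q _ _ (nbhs (l : R))); cvg_poly.
  by apply: cvgM; cvg_poly.
- move=> t; apply: (@continuous_min R _ (fun t => (3 * b t - 3 / 4) / (1 + th)) b t); last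
  exact: bc.
  apply: (@cvgM _ _ (nbhs (t : R))); last exact: cvg_cst.
  by apply: cvgB; [apply: cvgM; [exact: cvg_cst|exact: bc]|exact: cvg_cst].
- by move=> t /D01; exact: M0.
- by move=> t _; rewrite /f mulr0 subr0 Q_diag oppr_le0 exprn_even_ge0.
- move=> t /D01 ht; have [bM|Mb] := leP (b t) (M t).
    have -> : M t = b t by apply/eqP; rewrite eq_le bM ge_min lexx orbT.
    exact/ltW/facet.
  have eM : M t = (3 * b t - 3 / 4) / (1 + th).
    by move: Mb; rewrite /M gt_min ltxx orbF => /ltW; exact: min_l.
  have [|g1 g2 g3 _ _] := geom t (M t) ht; first by rewrite M0 ?lexx.
  have es : (b t - M t) + (b t - th * M t) + b t = 3 / 4.
    have : M t * (1 + th) = 3 * b t - 3 / 4 by rewrite eM divfK // gt_eqF.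
    clear; lra.
  have [e|ne] := eqVneq (M t) 0.
    rewrite /f e; have -> : b t = 1 / 4 by move: es; rewrite e; clear; lra.
    by rewrite mulr0 subr0 Q_center.
  apply: ltW; apply: Q_plane => //.
  by rewrite gtrBl lt_neqAle eq_sym ne M0.
- move=> t l l' /D01 ht /andP[l'0 ll'] lM fl.
  have lp := le_lt_trans l'0 ll'.
  have [|g1 g2 g3 g5 g4] := geom t l ht; first by rewrite lM ltW.
  (* The point with parameter l' lies on the segment from the point with parameter l to the
     diagonal, as [Q_to_diag] requires. *)
  have e1 : b t - l' = lerp ((l - l') / l) (b t - l) (b t).
    by rewrite /lerp; field; rewrite gt_eqF.
  have e2 : b t - th * l' = lerp ((l - l') / l) (b t - th * l) (b t).
    by rewrite /lerp; field; rewrite gt_eqF.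
  rewrite /f e1 e2; apply: Q_to_diag => //; first by rewrite gtrBl.
  by rewrite divr_gt0 ?subr_gt0 //= ler_pdivrMr // mul1r gerBl.
have mem t : 0 <= t <= 1 ->
    (open_cube R `&` Omega R) (pt (b t - r t) (b t - th * r t) (b t)).
  move=> ht; have [|/andP[r0 rM] hr'] := hr t; first by rewrite /= in_itv.
  have /eqP fr : f t (r t) == 0 by rewrite hr' ?eqxx // r0.
  have [|g1 g2 g3 _ _] := geom t (r t) ht; first by rewrite r0.
  split; last exact/Omega_pt.
  apply: ordered_cube => //; last exact: bu.
  rewrite lt_neqAle g1 andbT eq_sym subr_eq0; apply/eqP => e.
  by have := facet t ht; rewrite e fr ltxx => /(_ rM).
have r0 : r 0 = a3 - a1.
  have [|_ hr'] := hr 0; first by rewrite /= in_itv /= lexx ler01.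
  apply/esym/eqP; rewrite -hr'.
    by rewrite /f b0 eth !opprB !(addrC a3) !subrK hQ.
  rewrite le_min ler_pdivlMr // b0; clear -eth h1 h13 hs.
  by apply/andP; split; [|apply/andP; split]; lra.
have r1 : r 1 = 0.
  (* For b = 1/4 the diagonal point is already on the plane, so M 1 = 0. *)
  have [|/andP[r1 +] _] := hr 1; first by rewrite /= in_itv /= lexx ler01.
  rewrite le_min ler_pdivlMr // b1 => /andP[r2 _].
  have : 0 <= th * r 1 by rewrite mulr_ge0.
  clear -r1 r2; lra.
pose g t := pt (b t - r t) (b t - th * r t) (b t).
have -> : pt a1 a2 a3 = g 0 by rewrite /g r0 b0 eth !opprB !(addrC a3) !subrK.
have -> : pt (1 / 4) (1 / 4) (1 / 4) = g 1 by rewrite /g r1 b1 mulr0 subr0.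
apply: component_path => //.
have bc' : {within [set` `[0, 1]], continuous b} by exact: continuous_subspaceT.
move=> t; apply: cvg_pt; [apply: cvgB|apply: cvgB; last apply: cvgM|].
- exact: bc'.
- exact: rc.
- exact: bc'.
- exact: cvg_cst.
- exact: rc.
- exact: bc'.
Qed.

Lemma connected_from (T : topologicalType) (A : set T) (x : T) : A x ->
  (forall y, A y -> connected_component A y x) -> connected A.
Proof.
move=> Ax H.
have -> : A = connected_component A x.
  apply/seteqP; split; last exact: connected_component_sub.
  by move=> y /H /connected_component_sym.
exact: component_connected.
Qed.

Lemma connected_surface : connected (open_cube R `&` Omega R).
Proof.
pose c : 'rV[R]_3 := pt (1 / 4) (1 / 4) (1 / 4).
have hc : (open_cube R `&` Omega R) c.
  by split; [apply: ordered_cube; rewrite ?lexx //; lra|exact/Omega_pt/Q_center].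
apply: (connected_from hc) => a; rewrite (pt_eta a).
move: (a 0 0) (a 0 1) (a 0 2); apply: chamber_ind => [x y z H h|x y z H h|x y z hxyz].
- have [h' _] := symmetric_setI h.
  by have [] := component_swap (@symmetric_setI R) (H h').
- have [_ h'] := symmetric_setI h.
  by have [] := component_swap (@symmetric_setI R) (H h').
- move=> [/open_cube_pt[/andP[x0 x1] /andP[y0 y1] /andP[z0 z1]] /Omega_pt hQ].
  have [hs|hs] := leP (x + y + z) (3 / 4); first exact: lower_sheet.
  by apply: upper_sheet => //; exact: ltW.
Qed.
End SurfaceConnected.

(** * The complement *)

Section Complement.
Variable R : realType.
Local Notation C := (open_cube R `\` Omega R).

Lemma complement_pt (x y z : R) : open_cube R (pt x y z) -> Q x y z != 0 -> C (pt x y z).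
Proof. by move=> hc hQ; split=> // /Omega_pt h; rewrite h eqxx in hQ. Qed.

Lemma ordered_segment (x y z x' y' z' : R) :
  0 < x -> x <= y <= z -> z < 1 / 2 -> 0 < x' -> x' <= y' <= z' -> z' < 1 / 2 ->
  (forall t, 0 <= t <= 1 -> 0 < lerp t x x' ->
    lerp t x x' <= lerp t y y' <= lerp t z z' ->
    Q (lerp t x x') (lerp t y y') (lerp t z z') != 0) ->
  connected_component C (pt x y z) (pt x' y' z').
Proof.
move=> x0 /andP[xy yz] z1 x0' /andP[xy' yz'] z1' H; apply: component_segment => t ht.
have X0 : 0 < lerp t x x' by rewrite lt_lerp.
have XYZ : lerp t x x' <= lerp t y y' <= lerp t z z' by rewrite !ler_lerp.
by apply: complement_pt; [apply: ordered_cube => //; rewrite lerp_lt|exact: H].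
Qed.

Lemma ordered_scale (k x y z : R) : 0 < k -> 0 < x -> x <= y <= z ->
  [/\ 0 < k * x, 0 < k * y, k * x <= k * y <= k * z & k * x + k * y + k * z = k * (x + y + z)].
Proof.
move=> k0 x0 hxyz; rewrite !ler_pM2l // !mulr_gt0 // -?mulrDr //.
by case/andP: hxyz => xy _; exact: lt_le_trans xy.
Qed.

Lemma Q_diag_lt0 (b : R) : 0 < b -> b != 1 / 4 -> Q b b b < 0.
Proof.
move=> b0 b4; rewrite Q_diag oppr_lt0 exprn_even_gt0 // mulf_neq0 //.
  by rewrite expf_neq0 // subr_eq0; apply: contra_neq b4 => h; lra.
by rewrite gt_eqF //; lra.
Qed.

Lemma complement_low (x y z : R) : 0 < x -> x <= y <= z -> z < 1 / 2 ->
  x + y + z <= 3 / 4 -> Q x y z < 0 ->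
  connected_component C (pt x y z) (pt (1 / 8) (1 / 8) (1 / 8)).
Proof.
move=> x0 hxyz z1 hs hQ.
(* Scaling by 2/3 takes s1 <= 3/4 to s1 <= 1/2, the convex region of [Q_near0], which contains the
   target. *)
have k0 : 0 < 2 / 3 :> R by rewrite divr_gt0.
have [kx ky kxyz ks] := ordered_scale k0 x0 hxyz.
have [y0 z0] : 0 < y /\ 0 < z.
  case/andP: hxyz => xy yz; have y0 := lt_le_trans x0 xy.
  by split=> //; exact: lt_le_trans yz.
have kz : 2 / 3 * z < 1 / 2 by clear -z0 z1; lra.
apply: (@connected_component_trans _ _ (pt (2 / 3 * x) (2 / 3 * y) (2 / 3 * z))).
  apply: ordered_segment => // t ht _ _; rewrite !lerp_scale.
  have l0 : 0 < lerp t 1 (2 / 3) :> R by rewrite lt_lerp.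
  have l1 : lerp t 1 (2 / 3) <= 1 :> R by rewrite lerp_le // ler_pdivrMr // mul1r ler_nat.
  apply: ltr0_neq0; move: (lerp t 1 _) l0 l1 => l l0; rewrite le_eqVlt => /orP[/eqP ->|l1].
    by rewrite !mul1r.
  by apply: Q_contract; rewrite ?l0 // ltW.
have o8 : 0 < 1 / 8 :> R by rewrite divr_gt0.
apply: ordered_segment => //; rewrite ?lexx //; first by clear; lra.
move=> t ht X0 XYZ; apply/ltr0_neq0/Q_near0 => //.
by rewrite !lerpD lerp_le // ?ks; clear -hs; lra.
Qed.

(** [Q_to_diag] leads to (z, z, z); there z > 1/4, since z <= 1/4 would force the centre, so the
    diagonal is free of zeros up to the target. *)
Lemma complement_high (x y z : R) : 0 < x -> x <= y <= z -> z < 1 / 2 ->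
  3 / 4 <= x + y + z -> Q x y z < 0 ->
  connected_component C (pt x y z) (pt (3 / 8) (3 / 8) (3 / 8)).
Proof.
move=> x0 hxyz z1 hs hQ; case/andP: (hxyz) => xy yz.
have y0 := lt_le_trans x0 xy; have z0 := lt_le_trans y0 yz.
have hdiag : x = z -> y = z by move=> e; apply/eqP; rewrite eq_le yz -e xy.
have z4 : 1 / 4 < z.
  rewrite ltNge; apply/negP => z4; move: hQ.
  have -> : x = 1 / 4 by clear -xy yz z4 hs; lra.
  have -> : y = 1 / 4 by clear -xy yz z4 hs; lra.
  have -> : z = 1 / 4 by clear -xy yz z4 hs; lra.
  by rewrite Q_center ltxx.
have yz1 : y + z <= 1 by clear -yz z1; lra.
apply: (@connected_component_trans _ _ (pt z z z)).
  apply: ordered_segment => //; rewrite ?lexx // => t /andP[t0 t1] _ _.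
  apply: ltr0_neq0; rewrite lerpp.
  move: t0; rewrite le_eqVlt => /orP[/eqP <-|t0]; first by rewrite !lerp0.
  have [e|ne] := eqVneq x z; first by rewrite e hdiag // !lerpp -{1}e -{1}(hdiag e).
  have xz : x < z by rewrite lt_neqAle ne (le_trans xy).
  by apply: Q_to_diag; rewrite ?t0 // ltW.
apply: ordered_segment => //; rewrite ?lexx ?divr_gt0 //; first by clear; lra.
move=> t ht X0 _; apply/ltr0_neq0/Q_diag_lt0 => //.
by rewrite gt_eqF // lt_lerp //; clear; lra.
Qed.

Lemma Q_plane_gt0 (x y z : R) : 0 < x -> 0 < y -> 0 < z -> x + y + z = 3 / 4 ->
  1 / 4 < x \/ 1 / 4 < y \/ 1 / 4 < z -> 0 < Q x y z.
Proof.
move: x y z; apply: chamber_ind => [x y z H|x y z H|x y z hxyz] x0 y0 z0 hs hm.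
- rewrite Q_swap12; apply: H => //; first lra.
  by case: hm => [|[|]]; auto.
- rewrite Q_swap23; apply: H => //; first lra.
  by case: hm => [|[|]]; auto.
- have ? : x < z by case/andP: hxyz => ? ?; case: hm => [|[|]] ?; lra.
  by apply: Q_plane => //; exact: ltW.
Qed.

(** Given the sum 3/4, the disjunction excludes exactly the centre, and each alternative is
    convex. *)
Definition hexagon (x y z : R) := [/\ 0 < x < 1 / 2, 0 < y < 1 / 2, 0 < z < 1 / 2,
  x + y + z = 3 / 4 & 1 / 4 < x \/ 1 / 4 < y \/ 1 / 4 < z].

Lemma hexagon_segment (x y z x' y' z' : R) : hexagon x y z -> hexagon x' y' z' ->
  [\/ 1 / 4 < x /\ 1 / 4 < x', 1 / 4 < y /\ 1 / 4 < y' | 1 / 4 < z /\ 1 / 4 < z'] ->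
  connected_component C (pt x y z) (pt x' y' z').
Proof.
move=> [/andP[x0 x1] /andP[y0 y1] /andP[z0 z1] hs _].
move=> [/andP[x0' x1'] /andP[y0' y1'] /andP[z0' z1'] hs' _] hm.
apply: component_segment => t ht; apply: complement_pt.
  by apply/open_cube_pt; split; rewrite lt_lerp // lerp_lt.
apply: lt0r_neq0; apply: Q_plane_gt0; [exact: lt_lerp|exact: lt_lerp|exact: lt_lerp| |].
  by rewrite !lerpD hs hs' lerpp.
by case: hm => -[m m']; [left|right; left|right; right]; rewrite lt_lerp.
Qed.

(* Deleting the centre of the hexagon leaves the union of its three convex pieces a_i > 1/4. *)
Lemma hexagon_connected (x y z : R) : hexagon x y z ->
  connected_component C (pt x y z) (pt (1 / 3) (1 / 3) (1 / 12)).
Proof.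
have h3 : hexagon (1 / 3) (1 / 3) (1 / 12).
  by split; try (apply/andP; split; lra); [lra|left; lra].
(* A bridge lying in both pieces y > 1/4 and z > 1/4; the target itself has x, y > 1/4. *)
have h1 : hexagon (1 / 12) (1 / 3) (1 / 3).
  by split; try (apply/andP; split; lra); [lra|right; left; lra].
move=> h; have [_ _ _ _ [m|[m|m]]] := h.
- by apply: hexagon_segment => //; constructor 1; split=> //; lra.
- by apply: hexagon_segment => //; constructor 2; split=> //; lra.
- apply: (@connected_component_trans _ _ (pt (1 / 12) (1 / 3) (1 / 3))).
    by apply: hexagon_segment => //; constructor 3; split=> //; lra.
  by apply: hexagon_segment => //; constructor 2; split=> //; lra.
Qed.

Lemma ordered_hexagon (x y z : R) : 0 < x -> x <= y <= z -> z < 1 / 2 ->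
  x + y + z = 3 / 4 -> Q x y z != 0 -> hexagon x y z.
Proof.
move=> x0 hxyz z1 hs hQ; have /open_cube_pt[hx hy hz] := ordered_cube x0 hxyz z1.
case/andP: hxyz => xy yz; split=> //; right; right; rewrite ltNge; apply/negP => z4.
move: hQ; have -> : x = 1 / 4 by clear -xy yz z4 hs; lra.
have -> : y = 1 / 4 by clear -xy yz z4 hs; lra.
have -> : z = 1 / 4 by clear -xy yz z4 hs; lra.
by rewrite Q_center eqxx.
Qed.

(** Contrapositive of [Q_contract], applied to the scaled point with factor 1/k. *)
Lemma Q_pos_up (k x y z : R) : 0 < x -> x <= y <= z -> 0 < Q x y z ->
  1 <= k -> k * (x + y + z) <= 3 / 4 -> 0 < Q (k * x) (k * y) (k * z).
Proof.
move=> x0 hxyz hQ; rewrite le_eqVlt => /orP[/eqP <-|k1] ks; first by rewrite !mul1r.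
have k0 : 0 < k by rewrite (lt_trans _ k1).
have [a1 a2 a3 a4] := ordered_scale k0 x0 hxyz.
rewrite ltNge; apply/negP => hk.
have : Q (k^-1 * (k * x)) (k^-1 * (k * y)) (k^-1 * (k * z)) < 0.
  apply: Q_contract => //; rewrite ?a4 //; first exact: ltW.
  by rewrite invr_gt0 k0 invf_lt1.
by rewrite !mulKf ?gt_eqF // ltNge (ltW hQ).
Qed.

Lemma Q_pos_down (k x y z : R) : 0 < x -> x <= y <= z -> 0 < Q x y z -> y + z <= 1 ->
  0 < k <= 1 -> 3 / 4 <= k * (x + y + z) -> 0 < Q (k * x) (k * y) (k * z).
Proof.
move=> x0 hxyz hQ yz1 /andP[k0]; rewrite le_eqVlt => /orP[/eqP ->|k1] ks; first by rewrite !mul1r.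
have [a1 a2 a3 a4] := ordered_scale k0 x0 hxyz.
rewrite ltNge; apply/negP => hk.
have : Q (k^-1 * (k * x)) (k^-1 * (k * y)) (k^-1 * (k * z)) < 0.
  apply: Q_expand => //; rewrite ?a4 //; first exact: ltW.
    rewrite -mulrDr (le_trans _ yz1) // ler_piMl ?ltW //.
    case/andP: hxyz => xy yz; have y0 := lt_le_trans x0 xy.
    by rewrite addr_gt0 // (lt_le_trans y0).
  by rewrite invf_gt1.
by rewrite !mulKf ?gt_eqF // ltNge (ltW hQ).
Qed.

Lemma ray_segment (l x y z : R) : 0 < x -> x <= y <= z -> z < 1 / 2 -> 0 < l -> l * z < 1 / 2 ->
  (forall k, (l <= k <= 1) || (1 <= k <= l) -> 0 < Q (k * x) (k * y) (k * z)) ->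
  connected_component C (pt x y z) (pt (l * x) (l * y) (l * z)).
Proof.
move=> x0 hxyz z1 l0 lz H; have [lx ly lxyz _] := ordered_scale l0 x0 hxyz.
apply: ordered_segment => // t ht _ _; rewrite !lerp_scale; apply/lt0r_neq0/H.
apply/orP; have [l1|/ltW l1] := leP l 1; [left|right]; apply/andP; split.
- exact: le_lerp.
- exact: lerp_le.
- exact: le_lerp.
- exact: lerp_le.
Qed.

Lemma far_segment (x y z x' y' z' : R) :
  0 < x -> x <= y <= z -> z < 1 / 2 -> x + y + z <= 3 / 4 -> 1 / 2 <= z + 1 / 4 * x ->
  0 < x' -> x' <= y' <= z' -> z' < 1 / 2 -> x' + y' + z' <= 3 / 4 -> 1 / 2 <= z' + 1 / 4 * x' ->
  connected_component C (pt x y z) (pt x' y' z').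
Proof.
move=> x0 hxyz z1 hs hf x0' hxyz' z1' hs' hf'.
apply: ordered_segment => // t ht X0 XYZ; apply: lt0r_neq0; apply: Q_far => //.
- exact: ltW.
- by case/andP: XYZ => XY _; exact: lt_le_trans XY.
- by rewrite !lerpD lerp_le.
- have -> : lerp t x x' / 4 = lerp t (1 / 4 * x) (1 / 4 * x') by rewrite /lerp; field.
  by rewrite lerpD le_lerp.
Qed.

(* Along the ray through the point, Q stays positive up to the plane s1 = 3/4, but the ray may
   leave the cube first; it then meets the convex region of [far_segment], which reaches the
   plane inside the cube. *)
Lemma complement_outer (x y z : R) : 0 < x -> x <= y <= z -> z < 1 / 2 -> 0 < Q x y z ->
  exists x' y' z', hexagon x' y' z' /\ connected_component C (pt x y z) (pt x' y' z').
Proof.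
move=> x0 hxyz z1 hQ; case/andP: (hxyz) => xy yz.
have y0 := lt_le_trans x0 xy; have z0 := lt_le_trans y0 yz.
have yz1 : y + z <= 1 by clear -yz z1; lra.
pose s := x + y + z.
have s0 : 0 < s by rewrite !addr_gt0.
pose m := 3 / 4 / s.
have ms : m * s = 3 / 4 by rewrite divfK // gt_eqF.
have m0 : 0 < m by rewrite !divr_gt0.
have [mx my mxyz mS] := ordered_scale m0 x0 hxyz; rewrite -/s ms in mS.
have up (k : R) : 1 <= k <= m -> 0 < Q (k * x) (k * y) (k * z).
  by move=> /andP[k1 km]; apply: Q_pos_up => //; rewrite -/s -ms ler_pM2r.
have hexm : m * z < 1 / 2 -> 0 < Q (m * x) (m * y) (m * z) -> hexagon (m * x) (m * y) (m * z).
  by move=> mz mQ; apply: ordered_hexagon => //; rewrite gt_eqF.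
have [hs|hs] := leP (3 / 4) s.
  have m1 : m <= 1 by rewrite ler_pdivrMr // mul1r.
  have down (k : R) : m <= k <= 1 -> 0 < Q (k * x) (k * y) (k * z).
    move=> /andP[km k1]; have k0 := lt_le_trans m0 km.
    by apply: Q_pos_down; rewrite ?k0 //= -/s -ms ler_pM2r.
  have mz : m * z < 1 / 2 by rewrite (le_lt_trans _ z1) // ler_piMl // ltW.
  exists (m * x), (m * y), (m * z); split; first by apply: hexm => //; apply: down; rewrite lexx.
  apply: ray_segment => // k /orP[/down //|/andP[k1 k2]].
  by apply: up; rewrite k1.
have m1 : 1 < m by rewrite ltr_pdivlMr // mul1r.
have [mz|mz] := ltP (m * z) (1 / 2).
  exists (m * x), (m * y), (m * z); split.
    by apply: hexm => //; apply: up; rewrite lexx ltW.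
  apply: ray_segment => // k /orP[/andP[k1 k2]|/up //].
  by have := le_trans k1 k2; rewrite leNgt m1.
have zx : 0 < z + 1 / 4 * x by rewrite addr_gt0 // mulr_gt0.
(* The scaling at which the ray enters the region of [Q_far]; it is reached before the plane and
   while still inside the cube. *)
pose n := 1 / 2 / (z + 1 / 4 * x).
have en : n * (z + 1 / 4 * x) = 1 / 2 by rewrite divfK // gt_eqF.
have n0 : 0 < n by rewrite !divr_gt0.
have nm : n < m.
  rewrite -(ltr_pM2r zx) en (le_lt_trans mz) // ltr_pM2l //.
  by rewrite ltrDl mulr_gt0.
have [nx ny nxyz nS] := ordered_scale n0 x0 hxyz; rewrite -/s in nS.
have nz : n * z < 1 / 2 by rewrite -en ltr_pM2l // ltrDl mulr_gt0.
have ns : n * s <= 3 / 4 by rewrite -ms ler_pM2r // ltW.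
have far (k : R) : n <= k <= m -> 0 < Q (k * x) (k * y) (k * z).
  move=> /andP[nk km]; have k0 := lt_le_trans n0 nk.
  have [a1 a2 a3 a4] := ordered_scale k0 x0 hxyz.
  apply: Q_far => //; [exact: ltW|by rewrite a4 -/s -ms ler_pM2r|].
  have -> : k * z + k * x / 4 = k * (z + 1 / 4 * x) by clear; field.
  by rewrite -en ler_pM2r.
(* A point of the plane inside the cube with z + x / 4 = 0.505, hence in the region of
   [far_segment]. *)
exists (1 / 10), (17 / 100), (48 / 100); split.
  by clear; split; try (apply/andP; split; lra); [lra|right; right; lra].
apply: (@connected_component_trans _ _ (pt (n * x) (n * y) (n * z))).
  apply: ray_segment => // k /orP[/andP[k1 k2]|/andP[k1 k2]].
    by apply: far; rewrite k1 (le_trans k2) // ltW.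
  by apply: up; rewrite k1 (le_trans k2) // ltW.
have nf : 1 / 2 <= n * z + 1 / 4 * (n * x) by rewrite mulrCA -mulrDr en.
by apply: far_segment => //; rewrite ?nS //; clear; try (apply/andP; split); lra.
Qed.
End Complement.

(** * Counting the components of the complement *)

Section Count.
Variable R : realType.
Local Notation C := (open_cube R `\` Omega R).

Let q (a : 'rV[R]_3) : R := Q (a 0 0) (a 0 1) (a 0 2).
Let s (a : 'rV[R]_3) : R := a 0 0 + a 0 1 + a 0 2.

Lemma q_continuous : continuous q.
Proof.
move=> a; exact (cvg_Q _ (@rV_coord_continuous R 0 a) (@rV_coord_continuous R 1 a)
  (@rV_coord_continuous R 2 a)).
Qed.

Lemma s_continuous : continuous s.
Proof.
move=> a; exact (cvgD (cvgD (@rV_coord_continuous R 0 a) (@rV_coord_continuous R 1 a))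
  (@rV_coord_continuous R 2 a)).
Qed.

Lemma component_IVT (T : topologicalType) (A : set T) (f : T -> R) (a b : T) (v : R) :
  continuous f -> connected_component A a b -> f a <= v <= f b ->
  exists2 c, connected_component A a c & f c = v.
Proof.
move=> fc ab hv.
have ci : connected (f @` connected_component A a).
  apply: connected_continuous_connected; first exact: component_connected.
  exact: continuous_subspaceT.
have aa : connected_component A a a.
  by case: ab => B [Ba BA Bc] _; exists B.
have [c hc fcv] := (iffLR (connected_intervalP _) ci) _ _ (imageP f aa) (imageP f ab) v hv.
by exists c.
Qed.

Lemma q_nonzero (a b : 'rV[R]_3) : connected_component C a b -> q b != 0.
Proof. by move=> /connected_component_sub[_ h]; apply/eqP. Qed.

Lemma component_sign (a b : 'rV[R]_3) : connected_component C a b -> q a < 0 -> q b < 0.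
Proof.
move=> ab qa; rewrite ltNge; apply/negP => qb.
have [|c ac qc] := component_IVT (v := 0) q_continuous ab; first by rewrite ltW.
by have := q_nonzero ac; rewrite qc eqxx.
Qed.

(** Crossing the plane s1 = 3/4 would require a point with Q < 0 on it, but inside the cube Q is
    positive there except at the centre, where it is 0. *)
Lemma component_low (a b : 'rV[R]_3) : connected_component C a b -> q a < 0 ->
  s a < 3 / 4 -> s b < 3 / 4.
Proof.
move=> ab qa sa; rewrite ltNge; apply/negP => sb.
have [|c ac sc] := component_IVT (v := 3 / 4) s_continuous ab; first by rewrite ltW.
have := component_sign ac qa; rewrite ltNge => /negP; apply.
have [hc _] := connected_component_sub ac; move: hc sc; rewrite /q /s {1}(pt_eta c).
move: (c 0 0) (c 0 1) (c 0 2) => x y z.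
move=> /open_cube_pt[/andP[x0 _] /andP[y0 _] /andP[z0 _]] hs.
have [hx|hx] := ltP (1 / 4) x; first by rewrite ltW // Q_plane_gt0 //; left.
have [hy|hy] := ltP (1 / 4) y; first by rewrite ltW // Q_plane_gt0 //; right; left.
have [hz|hz] := ltP (1 / 4) z; first by rewrite ltW // Q_plane_gt0 //; right; right.
have -> : x = 1 / 4 by lra.
have -> : y = 1 / 4 by lra.
have -> : z = 1 / 4 by lra.
by rewrite Q_center.
Qed.

Definition rep (n : nat) : 'rV[R]_3 :=
  match n with
  | 0%N => pt (1 / 8) (1 / 8) (1 / 8)
  | 1%N => pt (3 / 8) (3 / 8) (3 / 8)
  | _ => pt (1 / 3) (1 / 3) (1 / 12)
  end.

Lemma q_rep : [/\ q (rep 0%N) < 0, q (rep 1%N) < 0 & 0 < q (rep 2%N)].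
Proof.
rewrite /q /rep !ptE; split.
- by apply: Q_diag_lt0; [lra|apply/eqP; lra].
- by apply: Q_diag_lt0; [lra|apply/eqP; lra].
- by apply: Q_plane_gt0; try lra; left; lra.
Qed.

Lemma rep_complement n : C (rep n).
Proof.
have [q0 q1 q2] := q_rep.
case: n => [|[|n]]; apply: complement_pt;
  try by apply/open_cube_pt; split; apply/andP; split; lra.
- by move: q0; rewrite /q /rep !ptE; exact: ltr0_neq0.
- by move: q1; rewrite /q /rep !ptE; exact: ltr0_neq0.
- by move: q2; rewrite /q /rep !ptE; exact: lt0r_neq0.
Qed.

Lemma component_rep (a : 'rV[R]_3) : C a ->
  exists2 n, (n < 3)%N & connected_component C a (rep n).
Proof.
rewrite (pt_eta a); move: (a 0 0) (a 0 1) (a 0 2).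
(* [rep 2] is not symmetric, so the claim for [chamber_ind] is made permutation invariant: any point
   of [hexagon] may replace it, while the other representatives lie on the diagonal. *)
suff H x y z : C (pt x y z) -> exists n x' y' z', [/\ (n < 3)%N,
    connected_component C (pt x y z) (pt x' y' z') &
    (n = 2%N /\ hexagon x' y' z') \/ ((n < 2)%N /\ rep n = pt x' x' x' /\ x' = y' /\ x' = z')].
  move=> x y z /H[n [x' [y' [z' [n3 h hn]]]]]; exists n => //.
  case: hn => [[-> hex]|[_ [-> [e1 e2]]]]; last by rewrite -e1 -e2 in h.
  exact: connected_component_trans h (hexagon_connected hex).
move: x y z; apply: chamber_ind => [x y z H|x y z H|x y z hxyz].
- move=> /symmetric_setD[/H[n [x' [y' [z' [n3 h hn]]]]] _].
  exists n, y', x', z'; split=> //; first by have [] := component_swap (@symmetric_setD R) h.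
  case: hn => [[-> [hx hy hz hs hm]]|[n2 [-> [<- <-]]]]; [left|by right].
  by split=> //; split=> //; [lra|case: hm => [|[|]]; auto].
- move=> /symmetric_setD[_ /H[n [x' [y' [z' [n3 h hn]]]]]].
  exists n, x', z', y'; split=> //; first by have [] := component_swap (@symmetric_setD R) h.
  case: hn => [[-> [hx hy hz hs hm]]|[n2 [-> [<- <-]]]]; [left|by right].
  by split=> //; split=> //; [lra|case: hm => [|[|]]; auto].
move=> [/open_cube_pt[/andP[x0 _] _ /andP[_ z1]] nO].
have : Q x y z != 0 by apply/eqP => h; apply: nO; exact/Omega_pt.
rewrite neq_lt => /orP[hQ|hQ]; last first.
  have [x' [y' [z' [hex h]]]] := complement_outer x0 hxyz z1 hQ.
  by exists 2%N, x', y', z'; split=> //; left.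
have [hs|hs] := leP (x + y + z) (3 / 4).
  by exists 0%N, (1 / 8), (1 / 8), (1 / 8); split=> //; [exact: complement_low|right].
by exists 1%N, (3 / 8), (3 / 8), (3 / 8); split=> //; [apply: complement_high => //; exact:
  ltW|right].
Qed.

(** The sign of Q separates the third representative from the first two, and the plane s1 = 3/4
    separates those from each other. *)
Lemma rep_inj (m n : nat) : (m < 3)%N -> (n < 3)%N ->
  connected_component C (rep m) = connected_component C (rep n) -> m = n.
Proof.
move=> m3 n3 e.
have mn : connected_component C (rep m) (rep n).
  by rewrite e; exact/connected_component_refl/rep_complement.
have nm := connected_component_sym mn.
have [q0 q1 q2] := q_rep.
have s0 : s (rep 0%N) < 3 / 4 by rewrite /s /rep !ptE; lra.
have s1 : 3 / 4 < s (rep 1%N) by rewrite /s /rep !ptE; lra.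
move: m n m3 n3 mn nm {e} => [|[|[|//]]] [|[|[|//]]] // _ _ mn nm.
- by have := component_low mn q0 s0; rewrite ltNge (ltW s1).
- by have := component_sign mn q0; rewrite ltNge (ltW q2).
- by have := component_low nm q0 s0; rewrite ltNge (ltW s1).
- by have := component_sign mn q1; rewrite ltNge (ltW q2).
- by have := component_sign nm q0; rewrite ltNge (ltW q2).
- by have := component_sign nm q1; rewrite ltNge (ltW q2).
Qed.

Lemma three_components : components C #= `I_3.
Proof.
have -> : components C = (fun n => connected_component C (rep n)) @` `I_3.
  apply/seteqP; split=> [_ [a Ca <-]|_ [n _ <-]]; last first.
    by exists (rep n) => //; exact: rep_complement.
  have [n n3 h] := component_rep Ca.
  by exists n => //; apply/esym/same_connected_component.
apply: inj_card_eq => m n; rewrite !inE /= => m3 n3; exact: rep_inj.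
Qed.
End Count.

Theorem theorem1 (R : realType) :
  connected (open_cube R `&` Omega R) /\
  components (open_cube R `\` Omega R) #= `I_3.
Proof. by split; [exact: connected_surface|exact: three_components]. Qed.
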